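(* Let $G$, $G'$ be finite groups, let $B$, $B'$ be blocks of $\mathcal{O}G$, $\mathcal{O}G'$, respectively, and assume that $K$ contains a primitive root of unity of order divisible by $|G|$ and $|G'|$. Suppose that $B$ and $B'$ are isotypic. Let $I:\mathrm{Irr}(B)\cong\mathrm{Irr}(B')$ be a bijection which is induced by an isotypy between $B$ and $B'$. Then for every $\chi\in\mathrm{Irr}(B)$ we have $c(I(\chi))_p=c(\chi)_p$.
   Context: Let $p$ be a prime, $\mathcal{O}$ a complete discrete valuation ring with residue field $k$ of characteristic $p$ and field of fractions $K$ of characteristic $0$. For a positive integer $n$, $\zeta_n$ denotes a primitive $n$-th root of unity in an extension field of $K$. For a block $B$ of $\mathcal{O}G$, $\mathrm{Irr}(B)$ is the set of $K$-valued irreducible characters of $G$ belonging to $B$, and $\mathbb{Z}\mathrm{Irr}(B)$ the group of generalised characters they generate. Conductors: for a set $S$ of cyclotomic integers, $c(S)$ is the smallest positive integer $n$ with $S\subseteq\mathbb{Q}(\zeta_n)$; for a generalised character $\chi$ of $G$, $c(\chi)=c(\{\chi(g)\mid g\in G\})$, and $c(\chi)_p$ is the highest power of $p$ dividing $c(\chi)$. Perfect isometries (Broué): an isometry is a group isomorphism $J:\mathbb{Z}\mathrm{Irr}(B)\to\mathbb{Z}\mathrm{Irr}(B')$ preserving the standard scalar products; it sends each $\chi\in\mathrm{Irr}(B)$ to $\pm$ an element of $\mathrm{Irr}(B')$ and so induces a bijection $\mathrm{Irr}(B)\cong\mathrm{Irr}(B')$. With $\mu(g',g)=\sum_{\chi\in\mathrm{Irr}(B)}J(\chi)(g')\chi(g^{-1})$,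 $J$ is perfect if for all $g\in G$, $g'\in G'$: (1) $\mu(g',g)/|C_G(g)|$ and $\mu(g',g)/|C_{G'}(g')|$ lie in $\mathcal{O}$; (2) $\mu(g',g)=0$ if exactly one of $g$, $g'$ has order prime to $p$. The $K$-linear extension of a perfect isometry sends class functions vanishing outside $p'$-elements to such class functions; denote by $J_{p'}$ the resulting map on these. Isotypies (in the version requiring a bijection of classes of Brauer elements): a $B$-Brauer element is a pair $(u,e)$ where $u\in G$ is a $p$-element and $e$ is a block (idempotent) of $\mathcal{O}C_G(u)$ such that $(\langle u\rangle,\bar e)$ is a $B$-Brauer pair, with $\bar e$ the image of $e$ in $kC_G(u)$ (i.e. $\mathrm{Br}_{\langle u\rangle}(1_B)\bar e\neq0$). For such a pair let $d^{(u,e)}$ be the map sending a $K$-valued class function $\chi$ in the $K$-span of $\mathrm{Irr}(B)$ to the class function on $C_G(u)$ with value $\chi(use)$ at $s\in C_G(u)$ of order prime to $p$ (with $\chi$ extended linearly to the group algebra) and value $0$ elsewhere. An isotypy between $B$ and $B'$ consists of a perfect isometry $I:\mathbb{Z}\mathrm{Irr}(B)\to\mathbb{Z}\mathrm{Irr}(B')$, a bijection $(u,e)\mapsto(u',e')$ between representatives of the $G$-conjugacy classes of $B$-Brauer elements and representatives of the $G'$-conjugacy classes of $B'$-Brauer elements, sending $(1,1_B)$ to $(1,1_{B'})$, and for each such $(u,e)$ a perfect isometry $I^{(u,e)}:\mathbb{Z}\mathrm{Irr}(\mathcal{O}C_G(u)e)\to\mathbb{Z}\mathrm{Irr}(\mathcal{O}C_{G'}(u')e')$,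 with $I^{(1,1_B)}=I$, such that $d^{(u',e')}\circ I=(I^{(u,e)})_{p'}\circ d^{(u,e)}$ on the $K$-span of $\mathrm{Irr}(B)$. $B$ and $B'$ are isotypic if an isotypy exists; the induced bijection $\mathrm{Irr}(B)\cong\mathrm{Irr}(B')$ is the one induced by $I$ (up to signs). *)

(* Defs.v *)
From mathcomp Require Import all_boot all_order all_fingroup all_algebra.
From mathcomp Require Import all_solvable all_field all_character.
From mathcomp Require Import boolp classical_sets functions fsbigop.

Set Implicit Arguments.
Unset Strict Implicit.
Unset Printing Implicit Defensive.

Import GroupScope GRing.Theory.
Local Open Scope group_scope.
Local Open Scope ring_scope.
Local Open Scope classical_set_scope.

Definition rdvd (R : pzRingType) (a x : R) : Prop := exists c, x = c * a.

Definition is_ideal (R : pzRingType) (I : set R) : Prop :=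
  I 0 /\ forall a x y, I x -> I y -> I (a * x + y).

Definition nonunits (R : unitRingType) : set R :=
  [set x | x \isn't a GRing.unit].

(* A local principal ideal domain that is not a field, complete for the adic
   topology of its maximal ideal. If pi generates the maximal ideal m then
   m ^ n = (pi ^ n); separatedness is automatic. *)
Record complete_dvr (O : idomainType) : Prop := CompleteDVR {
  dvr_principal : forall I : set O, is_ideal I ->
    exists a, I = [set x | rdvd a x];
  dvr_local : is_ideal (@nonunits O);
  dvr_nonfield : exists2 x : O, x != 0 & nonunits x;
  dvr_complete : forall pi : O, @nonunits O = [set x | rdvd pi x] ->
    forall a : nat -> O, (forall n, rdvd (pi ^+ n) (a n.+1 - a n)) ->
    exists l, forall n, rdvd (pi ^+ n) (l - a n)
}.

(* The triple (K, O, k): iota embeds O in its field of fractions K, and res is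
   reduction modulo the maximal ideal. *)
Record modular_system (p : nat) (O : idomainType) (K k : fieldType)
    (iota : {rmorphism O -> K}) (res : {rmorphism O -> k}) : Prop :=
  ModularSystem {
  modsys_prime : prime p;
  modsys_dvr : complete_dvr O;
  modsys_inj : injective iota;
  modsys_frac : forall x : K, exists a c : O, c != 0 /\ x = iota a / iota c;
  modsys_charK : [pchar K] =i pred0;
  modsys_surj : forall y : k, exists x : O, res x = y;
  modsys_ker : forall x : O, res x = 0 <-> nonunits x;
  modsys_chark : p \in [pchar k]
}.

(* For G : {group gT}, the group algebra RG is the set of functions gT -> R that
   vanish outside G, a function being identified with the formal sum of its
   values; the product is convolution (not the pointwise product). *)
Section GroupAlgebra.
Variables (gT : finGroupType) (R : comNzRingType).
Implicit Types (G : {group gT}) (a c e : {ffun gT -> R}).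

Definition in_galg G a : Prop := forall x, x \notin G -> a x = 0.

Definition gbasis (x : gT) : {ffun gT -> R} := [ffun y => (y == x)%:R].

Definition gmul a c : {ffun gT -> R} :=
  [ffun x => \sum_(y : gT) a y * c (y^-1 * x)%g].

Definition in_gcenter G a : Prop :=
  in_galg G a /\ forall c, in_galg G c -> gmul a c = gmul c a.

Definition central_idem G e : Prop := in_gcenter G e /\ gmul e e = e.

(* A block is represented by its identity element 1_B, a primitive idempotent
   of the centre of RG. *)
Definition is_block G e : Prop :=
  [/\ central_idem G e, e <> 0
    & forall f1 f2, central_idem G f1 -> central_idem G f2 ->
        gmul f1 f2 = 0 -> e = f1 + f2 -> f1 = 0 \/ f2 = 0].

Definition gconj e (g : gT) : {ffun gT -> R} := [ffun x => e (x ^ g^-1)%g].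

End GroupAlgebra.

Definition gmap (gT : finGroupType) (R S : comNzRingType)
    (f : {rmorphism R -> S}) (a : {ffun gT -> R}) : {ffun gT -> S} :=
  [ffun x => f (a x)].

Definition zspan (V : zmodType) (P : set V) : set V :=
  [set v | exists n (m : 'I_n -> int) (x : 'I_n -> V),
     (forall i, P (x i)) /\ v = \sum_(i < n) x i *~ m i].

Definition kspan (F : fieldType) (V : lmodType F) (P : set V) : set V :=
  [set v | exists n (m : 'I_n -> F) (x : 'I_n -> V),
     (forall i, P (x i)) /\ v = \sum_(i < n) m i *: x i].

(* K-valued class functions of G are functions on gT that vanish outside G;
   K^o provides the K-module structure. *)
Notation kfun gT K := {ffun gT -> K^o}.

Definition kfdot (gT : finGroupType) (K : fieldType) (G : {group gT})
    (phi psi : kfun gT K) : K :=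
  #|G|%:R^-1 * \sum_(x in G) (phi x : K) * psi (x^-1)%g.

(* phi extended linearly to the group algebra *)
Definition kfext (gT : finGroupType) (K : fieldType) (phi : kfun gT K)
    (a : {ffun gT -> K}) : K := \sum_(x : gT) a x * phi x.

(* The members of Irr(B) are the characters of the simple KG-modules on which
   1_B = b acts as the identity. *)
Definition Irr (O : idomainType) (K : fieldType) (iota : {rmorphism O -> K})
    (gT : finGroupType) (G : {group gT}) (b : {ffun gT -> O}) :
    set (kfun gT K) :=
  [set chi : kfun gT K | exists n (rG : mx_representation K G n),
     [/\ mx_irreducible rG,
         \sum_(x in G) iota (b x) *: rG x = 1%:M
       & chi = [ffun x => (\tr (rG x)) *+ (x \in G)]]].

Section PerfectIsometry.
Variables (p : nat) (O : idomainType) (K : fieldType).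
Variable iota : {rmorphism O -> K}.
Variables (gT gT' : finGroupType) (G : {group gT}) (G' : {group gT'}).
Variables (b : {ffun gT -> O}) (b' : {ffun gT' -> O}).

(* Since Irr(B) is linearly independent over K, a group homomorphism
   J : Z Irr(B) -> Z Irr(B') is the same as the restriction of a K-linear map;
   taking J linear from the start gives the K-linear extension of the isometry
   at once. Values of J outside the K-span of Irr(B) are never used. *)
Implicit Type J : {linear kfun gT K -> kfun gT' K}.

Definition is_isometry J : Prop :=
  set_bij (zspan (Irr iota G b)) (zspan (Irr iota G' b')) J /\
  forall phi psi, zspan (Irr iota G b) phi -> zspan (Irr iota G b) psi ->
    kfdot G' (J phi) (J psi) = kfdot G phi psi.

(* Irr(B) is finite, so this finitely supported sum is the sum over Irr(B). *)
Definition mu J (g' : gT') (g : gT) : K :=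
  \sum_(chi \in Irr iota G b) (J chi g' : K) * chi (g^-1)%g.

Definition perfect_isometry J : Prop :=
  is_isometry J /\
  forall g g', g \in G -> g' \in G' ->
    [/\ exists a : O, mu J g' g / #|'C_G[g]|%:R = iota a,
        exists a : O, mu J g' g / #|'C_G'[g']|%:R = iota a
      & p^'.-elt g != p^'.-elt g' -> mu J g' g = 0].

(* I0 is the bijection Irr(B) -> Irr(B') obtained from J by ignoring signs. *)
Definition induced_bijection J (I0 : kfun gT K -> kfun gT' K) : Prop :=
  set_bij (Irr iota G b) (Irr iota G' b') I0 /\
  forall chi, Irr iota G b chi -> J chi = I0 chi \/ J chi = - I0 chi.

End PerfectIsometry.

(* A Brauer element is a pair of a p-element u and a block idempotent of
   O C_G(u). *)
Notation belt gT O := (gT * {ffun gT -> O})%type.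

Section BrauerElements.
Variables (p : nat) (O : idomainType) (K k : fieldType).
Variables (iota : {rmorphism O -> K}) (res : {rmorphism O -> k}).
Variables (gT : finGroupType) (G : {group gT}) (b : {ffun gT -> O}).

(* Br_Q applied to the image in kG of a Q-stable element a of OG *)
Definition brauer_map (Q : {set gT}) (a : {ffun gT -> O}) : {ffun gT -> k} :=
  [ffun x => if x \in 'C_G(Q) then res (a x) else 0].

Definition brauer_element (ue : belt gT O) : Prop :=
  [/\ ue.1 \in G, p.-elt ue.1, is_block 'C_G[ue.1] ue.2
    & gmul (brauer_map <[ue.1]> b) (gmap res ue.2) <> 0].

Definition belt_conj (ue : belt gT O) (g : gT) : belt gT O :=
  ((ue.1 ^ g)%g, gconj ue.2 g).

Definition belt_reps (R : set (belt gT O)) : Prop :=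
  R `<=` [set ue | brauer_element ue] /\
  forall ue, brauer_element ue ->
    exists! r, R r /\ exists2 g, g \in G & r = belt_conj ue g.

Definition dec_map (ue : belt gT O) (chi : kfun gT K) : kfun gT K :=
  [ffun s => if (s \in 'C_G[ue.1]) && p^'.-elt s
             then kfext chi (gmul (gbasis K (ue.1 * s)%g) (gmap iota ue.2))
             else 0].

End BrauerElements.

Section Isotypy.
Variables (p : nat) (O : idomainType) (K k : fieldType).
Variables (iota : {rmorphism O -> K}) (res : {rmorphism O -> k}).
Variables (gT gT' : finGroupType) (G : {group gT}) (G' : {group gT'}).
Variables (b : {ffun gT -> O}) (b' : {ffun gT' -> O}).

(* In isotypy_dec the map (Iloc ue)_{p'} is the restriction of the K-linear map
   Iloc ue to functions vanishing outside p'-elements, such as dec_map _ _. *)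
Record is_isotypy (I : {linear kfun gT K -> kfun gT' K})
    (R : set (belt gT O)) (R' : set (belt gT' O))
    (f : belt gT O -> belt gT' O)
    (Iloc : belt gT O -> {linear kfun gT K -> kfun gT' K}) : Prop :=
  IsIsotypy {
  isotypy_perfect : perfect_isometry p iota G G' b b' I;
  isotypy_reps : belt_reps p res G b R;
  isotypy_reps' : belt_reps p res G' b' R';
  isotypy_bij : set_bij R R' f;
  isotypy_bij1 : f (1%g, b) = (1%g, b');
  isotypy_local : forall ue, R ue ->
    perfect_isometry p iota 'C_G[ue.1] 'C_G'[(f ue).1] ue.2 (f ue).2 (Iloc ue);
  isotypy_local1 : forall phi, zspan (Irr iota G b) phi ->
    Iloc (1%g, b) phi = I phi;
  isotypy_dec : forall ue, R ue -> forall phi, kspan (Irr iota G b) phi ->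
    dec_map p iota G' (f ue) (I phi) = Iloc ue (dec_map p iota G ue phi)
}.

Definition isotypic : Prop :=
  exists I R R' f Iloc, is_isotypy I R R' f Iloc.

Definition induced_by_isotypy (I0 : kfun gT K -> kfun gT' K) : Prop :=
  exists I R R' f Iloc,
    is_isotypy I R R' f Iloc /\ induced_bijection iota G G' b b' I I0.

End Isotypy.

(* x lies in the subfield Q(z) of L generated by z, for L of characteristic 0. *)
Definition in_Qadjoin (L : fieldType) (z x : L) : Prop :=
  exists r s : {poly rat},
    (map_poly ratr s).[z] != 0 /\
    x = (map_poly ratr r).[z] / (map_poly ratr s).[z].

(* S is contained in Q(zeta_n), with zeta_n in some extension field L of K. *)
Definition sub_cyclotomic (K : fieldType) (S : set K) (n : nat) : Prop :=
  exists (L : fieldType) (j : {rmorphism K -> L}) (z : L),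
    n.-primitive_root z /\ forall x, S x -> in_Qadjoin z (j x).

(* The conductor c(S); it is 0 by convention if S is not contained in any
   cyclotomic field. *)
Definition conductor (K : fieldType) (S : set K) : nat :=
  xget 0%N [set n | [/\ (0 < n)%N, sub_cyclotomic S n
    & forall m, (0 < m)%N -> sub_cyclotomic S m -> (n <= m)%N]].

Definition char_conductor (gT : finGroupType) (K : fieldType) (G : {group gT})
    (chi : kfun gT K) : nat :=
  conductor [set x : K | exists2 g, g \in G & x = chi g].

(* Main.v *)
Require Import Defs.
From mathcomp Require Import all_boot all_order all_fingroup all_algebra.
From mathcomp Require Import all_solvable all_field all_character.
From mathcomp Require Import boolp classical_sets.
From HB Require Import structures.
From mathcomp Require Import functions fsbigop ring.

(** Let [E] be a subfield of [K] that contains all roots of unity of order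
    dividing the [p']-part of [n], where [K] contains a primitive [n]-th root
    of unity and [n] is a common multiple of the group orders. The main point
    is that [chi] takes its values in [E] if and only if its image under the
    isotypy does. Applied to the fields generated by roots of unity of order
    [p ^ i * n`_(p^')], this determines the [p]-part of the conductor, because
    the orders [m] for which all the values lie in a field generated by a
    primitive [m]-th root of unity are closed under greatest common divisors.

    The local data transport the field of values. Every [x] in [G] is [u * s]
    with [u] its [p]-part, and [chi x] is the sum of the values at [s] of the
    [dec_map (u, e) chi], [e] running over the blocks of [C_G(u)]. By Brauer's
    second main theorem ([dec_map_not_brauer]) only Brauer elements contribute.
    Conversely the coefficients of [e] lie in [E] ([central_idem_image]), so the
    values of [dec_map (u, e) chi] lie in [E] if those of [chi] do. It remains
    to compare [dec_map (u, e) chi] with its image under the perfect isometry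
    [J] attached to [(u, e)]. The isometry commutes with restriction to
    [p']-elements ([isometry_preg]), hence sends the restriction of an
    irreducible character, which has values in [E], to a function with values
    in [E]; by linear algebra ([valued_descent]) it preserves the property of
    having values in [E], in both directions ([perfect_isometry_valued]).

    The block theory rests on one computation ([idem_trace_dvd]): if [f] is an
    idempotent commuting with [g] and [tau] is a class function, then expanding
    [f = f ^ N] with [N = p ^ a] writes the trace [tau (g f)] as a sum over words
    of length [N], on which a rotation twisted by [g] acts. Orbits of length
    divisible by [p ^ c] contribute multiples of [p ^ c], and the remaining
    words are periodic, which forces their letters to centralise the [p]-part
    of [g]. Letting [c] grow shows that [tau (g f)] vanishes in several
    situations: this yields Brauer's second main theorem, the fact that block
    idempotents are supported on [p']-elements, and the compatibility of the
    projection to a block with restriction to [p']-elements.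

    That [K] is a splitting field of the groups is never used. The field [K]
    contains the values of all characters, so class functions act by scalars on
    irreducible modules ([rext_scalar]); the irreducible [K]-characters form an
    orthogonal basis of the class functions, with norms that are positive
    integers. *)

Set Implicit Arguments.
Unset Strict Implicit.
Unset Printing Implicit Defensive.

Import GroupScope GRing.Theory.
Local Open Scope ring_scope.

(** * Divisibility and sums over orbits *)

Section Divisibility.
Variable R : comNzRingType.
Implicit Types a x y : R.

Lemma rdvd0 a : rdvd a 0.
Proof. by exists 0; rewrite mul0r. Qed.

Lemma rdvdD a x y : rdvd a x -> rdvd a y -> rdvd a (x + y).
Proof. by move=> [c ->] [d ->]; exists (c + d); rewrite mulrDl. Qed.

Lemma rdvd_sum a (T : Type) (s : seq T) (P : pred T) (F : T -> R) :
  (forall i, P i -> rdvd a (F i)) -> rdvd a (\sum_(i <- s | P i) F i).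
Proof. by move=> H; elim/big_ind: _ => //; [exact: rdvd0|exact: rdvdD]. Qed.

Lemma rdvdMr a x y : rdvd a x -> rdvd a (x * y).
Proof. by move=> [c ->]; exists (c * y); rewrite mulrAC. Qed.

Lemma rdvd_trans a x y : rdvd a x -> rdvd x y -> rdvd a y.
Proof. by move=> [c ->] [d ->]; exists (d * c); rewrite mulrA. Qed.

Lemma rdvd_prod a N (F : 'I_N -> R) :
  (forall i, rdvd a (F i)) -> rdvd (a ^+ N) (\prod_i F i).
Proof.
elim: N F => [|N IH] F H; first by exists 1; rewrite big_ord0 mul1r.
rewrite big_ord_recl exprS.
have [[c ->] [d ->]] := (H ord0, IH _ (fun i => H (lift ord0 i))).
by exists (c * d); rewrite mulrACA.
Qed.

End Divisibility.

Section OrbitSum.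
Variables (X : finType) (R : comNzRingType) (rho : {perm X}) (F : X -> R).
Hypothesis F_inv : forall x, F (rho x) = F x.

Lemma porbit_const x y : y \in porbit rho x -> F y = F x.
Proof.
case/porbitP => i ->; elim: i => [|i IH]; first by rewrite expg0 perm1.
by rewrite expgSr permM F_inv.
Qed.

(** The orbits of length divisible by [m] contribute a multiple of [m] to the
    sum of an invariant function. *)
Lemma orbit_sum_dvd (m : nat) :
  rdvd m%:R (\sum_(x | (m %| #|porbit rho x|)%N) F x).
Proof.
rewrite (partition_big (porbit rho) xpredT) //=; apply: rdvd_sum => A _.
have [x /andP[dvx /eqP defA]|no] := pickP (fun x => (m %| #|porbit rho x|)%N && (porbit rho x == A)).
  rewrite (eq_bigl (fun i => i \in A)) => [|y]; last first.
    rewrite -defA -eq_porbit_mem eq_sym; case: eqP => [e|]; rewrite ?andbF //.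
    by rewrite -e dvx.
  rewrite (eq_bigr (fun=> F x)) => [|y]; last by rewrite -defA; exact: porbit_const.
  rewrite sumr_const -defA; case/dvdnP: dvx => d ->.
  by exists (F x *+ d); rewrite mulr_natr -mulrnA.
by rewrite big_pred0 //; exact: rdvd0.
Qed.

End OrbitSum.

(** * Words over a group and their twisted rotation *)

Section IdempotentWords.
Variables (gT : finGroupType) (R : comNzRingType) (f : {ffun gT -> R}).
Hypothesis f_idem : gmul f f = f.

Lemma sum_gmul (a c : {ffun gT -> R}) (h : gT -> R) :
  \sum_x gmul a c x * h x = \sum_x \sum_y a x * c y * h (x * y)%g.
Proof.
transitivity (\sum_x \sum_y a y * c (y^-1 * x)%g * h x).
  by apply: eq_bigr => x _; rewrite ffunE mulr_suml.
rewrite exchange_big; apply: eq_bigr => y _ /=.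
rewrite (reindex_inj (mulgI y)) /=; apply: eq_bigr => x _.
by rewrite mulKg.
Qed.

(** The expansion of [f = f ^ (M + 1)] as a sum over words of length [M + 1]. *)
Lemma idem_word_sum M (h : gT -> R) :
  \sum_x f x * h x =
  \sum_(w : {ffun 'I_M.+1 -> gT}) (\prod_i f (w i)) * h (\prod_i w i)%g.
Proof.
elim: M h => [|M IH] h.
  rewrite (reindex (fun x => [ffun _ : 'I_1 => x])) /=; last first.
    exists (fun w : {ffun 'I_1 -> gT} => w ord0) => [x _|w _]; first by rewrite ffunE.
    by apply/ffunP => i; rewrite ffunE (ord1 i).
  by apply: eq_bigr => x _; rewrite !big_ord1 ffunE.
pose cns (q : gT * {ffun 'I_M.+1 -> gT}) : {ffun 'I_M.+2 -> gT} :=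
  [ffun i => if unlift ord0 i is Some j then q.2 j else q.1].
rewrite (reindex cns) /=; last first.
  exists (fun w : {ffun 'I_M.+2 -> gT} => (w ord0, [ffun i => w (lift ord0 i)])) => [[x w] _|w _].
    congr pair; first by rewrite ffunE unlift_none.
    by apply/ffunP => i; rewrite !ffunE liftK.
  by apply/ffunP => i; rewrite ffunE; case: unliftP => [j|] -> //=; rewrite ffunE.
rewrite -(pair_bigA _ (fun x w => (\prod_i f (cns (x, w) i)) * h (\prod_i cns (x, w) i)%g)) /=.
rewrite -[in LHS]f_idem sum_gmul; apply: eq_bigr => x _.
transitivity (f x * (\sum_y f y * h (x * y)%g)).
  by rewrite mulr_sumr; apply: eq_bigr => y _; rewrite mulrA.
rewrite IH mulr_sumr; apply: eq_bigr => w _.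
have cns0 : cns (x, w) ord0 = x by rewrite ffunE unlift_none.
have cnsS i : cns (x, w) (lift ord0 i) = w i by rewrite ffunE liftK.
have -> : \prod_i f (cns (x, w) i) = f x * \prod_i f (w i).
  by rewrite big_ord_recl cns0; congr (_ * _); apply: eq_bigr => i _; rewrite cnsS.
have -> : (\prod_i cns (x, w) i = x * \prod_i w i)%g.
  by rewrite big_ord_recl cns0; congr (_ * _)%g; apply: eq_bigr => i _; rewrite cnsS.
by rewrite mulrA.
Qed.

End IdempotentWords.

Section TwistedRotation.
Local Open Scope group_scope.
Variables (gT : finGroupType) (g : gT) (M : nat).
Local Notation N := M.+1.
Local Notation word := {ffun 'I_N -> gT}.
Implicit Type w : word.

(** The extension of a word [w] of length [N] to an infinite sequence satisfying
    [x_(k + N) = g x_k g^-1]. *)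
Definition word_ext w (k : nat) : gT := w (inord (k %% N)) ^ (g ^- (k %/ N)).

Lemma word_ext_ord w (i : 'I_N) : word_ext w i = w i.
Proof. by rewrite /word_ext modn_small // divn_small // expg0 invg1 conjg1 inord_val. Qed.

Lemma word_extDN w k : word_ext w (k + N) = word_ext w k ^ g^-1.
Proof.
rewrite /word_ext modnDr divnDr // divnn /= addn1 expgSr invMg -conjgM.
by rewrite -!expgVn; congr (_ ^ _); rewrite -expgS -expgSr.
Qed.

Lemma word_extN w : word_ext w N = w ord0 ^ g^-1.
Proof. by rewrite -[N]/(val (@ord0 M) + N)%N word_extDN word_ext_ord. Qed.

Lemma word_extDMN w k m : word_ext w (k + m * N) = word_ext w k ^ (g ^- m).
Proof.
elim: m => [|m IH]; first by rewrite addn0 invg1 conjg1.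
by rewrite mulSnr addnA word_extDN IH -conjgM -invMg -expgS.
Qed.

(** Rotation of a word, twisted by [g]: the first letter is conjugated by
    [g^-1] and moved to the end; the extended sequence is shifted by one. *)
Definition word_shift w : word := [ffun i => word_ext w (val i).+1].

Lemma word_ext_shift w k : word_ext (word_shift w) k = word_ext w k.+1.
Proof.
rewrite {1}/word_ext ffunE /= inordK ?ltn_mod // -word_extDMN addSn.
by rewrite [(k %% _ + _)%N]addnC -divn_eq.
Qed.

Lemma word_shift_inj : injective word_shift.
Proof.
move=> w w' e; have E k : word_ext w k = word_ext w' k.
  have : word_ext w (k + N) = word_ext w' (k + N) by rewrite addnS -!word_ext_shift e.
  by rewrite !word_extDN => /conjg_inj.
by apply/ffunP => i; rewrite -!word_ext_ord E.
Qed.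

Definition twist_rot := perm word_shift_inj.

Lemma twist_rotE w (i : 'I_N) : twist_rot w i = word_ext w i.+1.
Proof. by rewrite permE ffunE. Qed.

Lemma word_ext_rotX w m k : word_ext ((twist_rot ^+ m)%g w) k = word_ext w (m + k).
Proof.
elim: m k => [|m IH] k; first by rewrite expg0 perm1.
by rewrite expgSr permM permE word_ext_shift IH addnS.
Qed.

Lemma twist_rot_period w m : (twist_rot ^+ m)%g w = w -> forall k, word_ext w (m + k) = word_ext w k.
Proof. by move=> e k; rewrite -word_ext_rotX e. Qed.

Lemma word_ext_inj w w' : (forall k, word_ext w k = word_ext w' k) -> w = w'.
Proof. by move=> E; apply/ffunP => i; rewrite -!word_ext_ord E. Qed.

Lemma order_twist_rot : (#[twist_rot] %| N * #[g])%N.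
Proof.
rewrite order_dvdn; apply/eqP/permP => w; rewrite perm1.
apply: word_ext_inj => k; rewrite word_ext_rotX addnC mulnC word_extDMN.
by rewrite expg_order invg1 conjg1.
Qed.

Lemma card_porbit_twist_rot w : (#|porbit twist_rot w| %| N * #[g])%N.
Proof.
apply: dvdn_trans order_twist_rot.
by rewrite porbit.unlock /order; exact: dvdn_orbit.
Qed.

End TwistedRotation.

(** In this section [u] and [s] are the [p]-part and the [p']-part of [g], and
    [q] is the order of [s]. *)
Section PeriodicWords.
Local Open Scope group_scope.
Variables (gT : finGroupType) (p : nat) (G : {group gT}) (g : gT) (M : nat).
Hypothesis Gg : g \in G.
Local Notation N := M.+1.
Variable w : {ffun 'I_N -> gT}.
Local Notation u := (g.`_p).
Local Notation s := (g.`_p^').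
Local Notation q := (#[g]`_(p^'))%N.
Local Notation ext := (word_ext g w).
Local Notation W := (\prod_i w i).

Lemma constt_expn_p' : g ^+ q = u ^+ q.
Proof.
rewrite -{1}(consttC p g) expgMn; last exact: commuteX2.
have -> : s ^+ q = 1 by rewrite -(order_constt p^' g) expg_order.
by rewrite mulg1.
Qed.

Lemma cent1_p'_power x : commute x (g ^+ q) -> commute x u.
Proof.
rewrite constt_expn_p' => cxu; apply/cent1P; rewrite cent1C.
have: generator <[u]> (u ^+ q).
  by rewrite generator_coprime order_constt coprime_partC.
move/eqP=> e; have uq: u \in <[u ^+ q]> by rewrite -e cycle_id.
have sub: <[u ^+ q]> \subset 'C[x] by rewrite cycle_subG cent1C; exact/cent1P.
exact: (fintype.subsetP sub).
Qed.

Lemma prod_nat_shift (F : nat -> gT) a c :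
  \prod_(a <= i < a + c) F i = \prod_(0 <= i < c) F (i + a)%N.
Proof. by rewrite -{1}[a]add0n big_addn addKn. Qed.

(** The product of the first [m * N] letters. *)
Lemma prod_word_ext m : \prod_(0 <= i < m * N) ext i = (W * g) ^+ m * g ^- m.
Proof.
elim: m => [|m IH]; first by rewrite big_geq // invg1 mulg1.
rewrite mulSnr (@big_cat_nat _ _ _ (m * N)) ?leq_addr //= IH.
rewrite prod_nat_shift.
rewrite (eq_bigr (fun i => ext i ^ g ^- m)) => [|i _]; last by rewrite word_extDMN.
rewrite big_mkord.
have -> : \prod_(i < N) ext i ^ g ^- m = W ^ (g ^- m).
  rewrite (big_morph (conjg^~ (g ^- m)) (fun x y => conjMg x y _) (conj1g _)).
  by apply: eq_bigr => i _; rewrite word_ext_ord.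
rewrite conjgE invgK expgSr [in g ^+ m.+1]expgSr invMg !mulgA.
by rewrite mulgKV mulgK.
Qed.

Variable P : nat.
Hypothesis w_per : forall k, ext (P + k) = ext k.

Lemma word_ext_periodM m k : ext (m * P + k) = ext k.
Proof. by elim: m => [|m IH] //; rewrite mulSn -addnA w_per. Qed.

Lemma prod_word_ext_period m :
  \prod_(0 <= i < m * P) ext i = (\prod_(0 <= i < P) ext i) ^+ m.
Proof.
elim: m => [|m IH]; first by rewrite big_geq.
rewrite mulSnr (@big_cat_nat _ _ _ (m * P)) ?leq_addr //= IH expgSr.
rewrite (prod_nat_shift _ (m * P)); congr (_ * _).
by apply: eq_bigr => i _; rewrite addnC word_ext_periodM.
Qed.

Variable e : nat.
Hypothesis Pe : (q * N = e * P)%N.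

Lemma periodic_cent k : commute (ext k) u.
Proof.
apply: cent1_p'_power; apply/commgP/conjg_fixP/(canLR (conjgKV _)); symmetry.
by rewrite -word_extDMN addnC Pe word_ext_periodM.
Qed.

Hypothesis wG : forall i, w i \in G.
Hypothesis dvde : dvdn (partn #|G| p) e.

Lemma word_ext_in k : ext k \in G.
Proof. by rewrite groupJ ?wG // groupV groupX. Qed.

(** If the extended word is periodic with a period [P] such that
    [q * N = e * P], where the [p]-part of the order of [G] divides [e], then all
    its letters centralise [u], so that [(W s) ^ q] is the product of the first
    [q * N] letters, which is an [e]-th power by periodicity, hence a
    [p']-element. *)
Lemma periodic_p_regular :
  [/\ s * W \in 'C_G[u], p^'.-elt (s * W) & g * W = u * (s * W)].
Proof.
have cuW : commute W u.
  apply/commute_sym; apply: (big_ind (commute u)) => [|x y|i _].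
  - exact: commute1.
  - exact: commuteM.
  - by rewrite -(word_ext_ord g); apply/commute_sym/periodic_cent.
have cus : commute s u by exact: commuteX2.
have cWs : commute (W * s) u by apply/commute_sym/commuteM; exact/commute_sym.
have GW : W \in G by apply: group_prod.
have Gs : s \in G by rewrite groupX.
split; last by rewrite mulgA consttC.
  rewrite inE groupM // cent1C; apply/cent1P.
  by apply/commuteM; exact/commute_sym.
have -> : s * W = (W * s) ^ W by rewrite conjgE -mulgA mulKg.
rewrite /p_elt orderJ -/(p_elt _ _).
have Wsq : (W * s) ^+ q = (\prod_(0 <= i < P) ext i) ^+ e.
  rewrite -prod_word_ext_period -Pe prod_word_ext constt_expn_p'.
  have -> : W * g = (W * s) * u by rewrite -mulgA cus consttC.
  by rewrite (expgMn _ cWs) mulgK.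
have : p^'.-elt ((W * s) ^+ q).
  rewrite Wsq; set Y := \prod_(_ <= _ < _) _.
  have GY : Y \in G by apply: group_prod => i _; exact: word_ext_in.
  have : (#[Y ^+ e] %| partn #|G| p^')%N.
    rewrite order_dvdn -expgM; apply/eqP; case/dvdnP: dvde => d ->.
    by rewrite -mulnA partnC // mulnC expgM expg_cardG ?expg1n.
  by move=> d; apply: pnat_dvd d (part_pnat _ _).
have dq : (#[W * s] %| q * #[(W * s) ^+ q])%N by rewrite order_dvdn expgM expg_order.
by move=> H; apply: pnat_dvd dq _; rewrite pnatM part_pnat.
Qed.

End PeriodicWords.

(** * Traces of idempotents of group algebras *)
(** [f] is an idempotent of the group algebra fixed under conjugation by [g], and
    [tau] is a class function. Besides, either [f] vanishes modulo [pi] on the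
    centraliser of the [p]-part [u] of [g], or [tau] vanishes on the [p]-section
    of [u]; the latter is the set of conjugates of the [u * v] with [v] a
    [p']-element centralising [u]. *)
Section IdempotentTrace.
Variables (gT : finGroupType) (R : comNzRingType) (p : nat) (G : {group gT}).
Variables (pi : R) (g : gT) (f : {ffun gT -> R}) (tau : gT -> R).
Hypotheses (p_pr : prime p) (pi_p : rdvd pi p%:R) (Gg : g \in G).
Hypotheses (f_G : in_galg G f) (f_idem : gmul f f = f).
Hypothesis f_inv : forall x, f (x ^ g)%g = f x.
Hypothesis tau_class : {in G &, forall x y, tau (x ^ y)%g = tau x}.
Hypothesis f_or_tau :
  (forall x, x \in 'C_G[g.`_p]%g -> rdvd pi (f x)) \/
  (forall v, v \in 'C_G[g.`_p]%g -> (p^').-elt v -> tau (g.`_p * v)%g = 0).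

Section Words.
Variable M : nat.
Local Notation word := {ffun 'I_M.+1 -> gT}.

Let F (w : word) := (\prod_i f (w i)) * tau (g * \prod_i w i)%g.

Let F0 (w : word) i : w i \notin G -> F w = 0.
Proof. by move=> wi; rewrite /F (bigD1 i) //= f_G // !mul0r. Qed.

(** The term of the word [w] in the expansion is invariant under twisted
    rotation, since [tau] is a class function and [f] is fixed by [g]. *)
Lemma word_rot (w : word) : F (twist_rot g M w) = F w.
Proof.
have [/forallP wG|] := boolP [forall i, w i \in G]; last first.
  rewrite negb_forall => /existsP[i wi]; rewrite (F0 wi).
  case: (unliftP ord0 i) => [j|] ei; last first.
    apply: (@F0 _ ord_max); rewrite twist_rotE word_extN.
    by rewrite memJ_norm ?groupV ?(fintype.subsetP (normG G)) // -ei.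
  apply: (@F0 _ (widen_ord (leqnSn M) j)); rewrite twist_rotE.
  by rewrite (_ : _.+1 = lift ord0 j) // word_ext_ord -ei.
have ext_G k : word_ext g w k \in G by apply: word_ext_in.
rewrite /F; congr (_ * _).
  rewrite big_ord_recr [RHS]big_ord_recl mulrC; congr (_ * _).
    by apply: eq_bigr => i _; rewrite twist_rotE -(word_ext_ord g w (lift _ _)).
  by rewrite twist_rotE word_extN -f_inv conjgKV.
pose A := (\prod_(i < M) word_ext g w i.+1)%g.
have GA : A \in G by apply: group_prod => i _.
have -> : (\prod_i (twist_rot g M w) i = A * w ord0 ^ g^-1)%g.
  rewrite big_ord_recr /=; congr (_ * _)%g; first by apply: eq_bigr => i _; rewrite twist_rotE.
  by rewrite twist_rotE word_extN.
have -> : (\prod_i w i = w ord0 * A)%g.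
  by rewrite big_ord_recl; congr (_ * _)%g; apply: eq_bigr => i _; rewrite -(word_ext_ord g w (lift _ _)).
have -> : (g * (A * w ord0 ^ g^-1) = (A * g * w ord0) ^ g^-1)%g.
  by rewrite !conjgE invgK !mulgA.
have -> : (A * g * w ord0 = (g * (w ord0 * A)) ^ A^-1)%g.
  by rewrite conjgE invgK !mulgA mulgK.
by rewrite !tau_class ?groupV ?groupM ?groupJ ?groupV // !groupM.
Qed.

(** A word whose orbit has length not divisible by [p ^ j.+1] is periodic with
    period [p ^ j * q], [q] being the [p']-part of the order of [g]; hence either
    all the values of [f] at its letters are divisible by [pi], or [tau] vanishes
    at the product. *)
Lemma word_periodic j a (w : word) : M.+1 = (p ^ a)%N -> (j <= a)%N ->
  (partn #|G| p %| p ^ (a - j))%N ->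
  ~~ (p ^ j.+1 %| #|porbit (twist_rot g M) w|)%N ->
  rdvd (pi ^+ M.+1) (F w).
Proof.
move=> Ma le_ja dvdG ndv.
have [/forallP wG|] := boolP [forall i, w i \in G]; last first.
  by rewrite negb_forall => /existsP[i wi]; rewrite (F0 wi); exact: rdvd0.
have dt := card_porbit_twist_rot g w; set t := #|_| in ndv dt.
have t_gt0 : (0 < t)%N by apply: dvdn_gt0 dt; rewrite muln_gt0 order_gt0.
have tP : (t %| p ^ j * partn #[g] p^')%N.
  rewrite -(partnC p t_gt0) dvdn_mul //.
    rewrite p_part dvdn_exp2l //; move: ndv; rewrite pfactor_dvdn // -ltnNge; exact: id.
  have pa1 : partn (p ^ a) p^' = 1%N.
    by rewrite part_p'nat // pnatNK pnatX pnat_id.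
  rewrite -[partn #[g] _]mul1n -pa1 -partnM ?order_gt0 ?expn_gt0 ?prime_gt0 //.
  by rewrite -Ma partn_dvd // muln_gt0 order_gt0.
have w_per k : word_ext g w (p ^ j * partn #[g] p^' + k)%N = word_ext g w k.
  apply: twist_rot_period => //; case/dvdnP: tP => d ->; rewrite mulnC expgM.
  by rewrite permX; elim: d => //= d ->; rewrite permX iter_porbit.
have Pe : (partn #[g] p^' * M.+1 = p ^ (a - j) * (p ^ j * partn #[g] p^'))%N.
  by rewrite mulnA -expnD subnK // Ma mulnC.
case: f_or_tau => [fpi|tau0].
  apply: rdvdMr; apply: rdvd_prod => i; apply: fpi; rewrite inE wG cent1C.
  by apply/cent1P/commute_sym; rewrite -(word_ext_ord g); apply: periodic_cent w_per _ Pe _.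
have [v_in v_p gW] := periodic_p_regular Gg w_per Pe wG dvdG.
by rewrite /F gW tau0 // mulr0; exact: rdvd0.
Qed.

End Words.

(** The trace of [g f] with respect to [tau] is divisible by every power of
    [pi]. *)
Lemma idem_trace_dvd c : rdvd (pi ^+ c) (\sum_x f x * tau (g * x)%g).
Proof.
(* The words have length [p ^ a]; [a] exceeds [c] by enough for [p ^ (a - c)] to
   be a multiple of the [p]-part of the order of [G]. *)
pose a := (c + logn p #|G|)%N.
have pa : (p ^ a)%N.-1.+1 = (p ^ a)%N by rewrite prednK // expn_gt0 prime_gt0.
rewrite (idem_word_sum f_idem (p ^ a)%N.-1 (fun x => tau (g * x)%g)).
rewrite (bigID (fun w => (p ^ c %| #|porbit (twist_rot g (p ^ a)%N.-1) w|)%N)) /=; apply: rdvdD.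
  apply: rdvd_trans (orbit_sum_dvd (@word_rot _) _).
  case: pi_p => d e; exists (d ^+ c); by rewrite natrX e exprMn.
apply: rdvd_sum => w; case: c @a pa w => [|j] a pa w; first by rewrite dvd1n.
move=> ndv; apply: (@rdvd_trans _ _ (pi ^+ (p ^ a)%N.-1.+1)).
  have le : (j.+1 <= (p ^ a)%N.-1.+1)%N.
    by rewrite pa (leq_trans _ (ltnW (ltn_expl _ (prime_gt1 p_pr)))) // leq_addr.
  by exists (pi ^+ ((p ^ a)%N.-1.+1 - j.+1)); rewrite -exprD subnK.
apply: (@word_periodic _ j a w) ndv => //; first by rewrite /a addSnnS leq_addr.
by rewrite p_part dvdn_exp2l // /a addSnnS addKn.
Qed.

End IdempotentTrace.

(** * Group algebras and class functions over a modular system *)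
Section GroupAlgebraTheory.
Variables (gT : finGroupType) (R : comNzRingType).
Implicit Types (a c d : {ffun gT -> R}) (G : {group gT}).

(** An element of the group algebra is determined by the linear extensions of
    all functions. *)
Lemma galg_ext a c : (forall h, \sum_x a x * h x = \sum_x c x * h x) -> a = c.
Proof.
have E b y : \sum_x b x * (x == y)%:R = b y :> R.
  by rewrite (bigD1 y) //= eqxx mulr1 big1 ?addr0 // => x /negPf->; exact: mulr0.
by move=> H; apply/ffunP => y; rewrite -E H E.
Qed.

Lemma gmulA a c d : gmul a (gmul c d) = gmul (gmul a c) d.
Proof.
apply: galg_ext => h; rewrite !sum_gmul.
transitivity (\sum_x gmul a c x * \sum_y d y * h (x * y)%g); last first.
  by apply: eq_bigr => x _; rewrite mulr_sumr; apply: eq_bigr => y _; rewrite mulrA.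
rewrite sum_gmul; apply: eq_bigr => x _.
transitivity (a x * \sum_y gmul c d y * h (x * y)%g).
  by rewrite mulr_sumr; apply: eq_bigr => y _; rewrite mulrA.
rewrite sum_gmul mulr_sumr; apply: eq_bigr => y _.
by rewrite !mulr_sumr; apply: eq_bigr => z _; rewrite mulgA !mulrA.
Qed.

Lemma sum_gbasis g (h : gT -> R) : \sum_x gbasis R g x * h x = h g.
Proof.
rewrite (bigD1 g) //= ffunE eqxx mul1r big1 ?addr0 // => x /negPf ne.
by rewrite ffunE ne mul0r.
Qed.

Lemma gmul_gbasisl g a x : gmul (gbasis R g) a x = a (g^-1 * x)%g.
Proof. by rewrite ffunE (sum_gbasis g (fun y => a (y^-1 * x)%g)). Qed.

Lemma gmul_gbasisr g a x : gmul a (gbasis R g) x = a (x * g^-1)%g.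
Proof.
rewrite ffunE (bigD1 (x * g^-1)%g) //= ffunE invMg invgK mulgKV eqxx mulr1.
rewrite big1 ?addr0 // => y ne; rewrite ffunE [_ == _]negbTE ?mulr0 //.
by apply: contraNneq ne => <-; rewrite invMg invgK mulKVg.
Qed.

Lemma gbasis_galg G g : g \in G -> in_galg G (gbasis R g).
Proof. by move=> Gg x; rewrite ffunE; case: eqP => // ->; rewrite Gg. Qed.

Lemma gmul_galg G a c : in_galg G a -> in_galg G c -> in_galg G (gmul a c).
Proof.
move=> aG cG x nGx; rewrite ffunE big1 // => y _.
have [Gy|/aG->] := boolP (y \in G); last by rewrite mul0r.
by rewrite cG ?mulr0 // groupMl ?groupV.
Qed.

Lemma gcenterJ G a g x : in_gcenter G a -> g \in G -> a (x ^ g)%g = a x.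
Proof.
move=> [aG cen] Gg; have /ffunP/(_ (g^-1 * x)%g) := cen _ (gbasis_galg (groupVr Gg)).
rewrite gmul_gbasisr gmul_gbasisl !invgK mulKVg => <-.
by rewrite conjgE mulgA.
Qed.

End GroupAlgebraTheory.

(** Class functions of [G], extended by zero to the ambient group. *)
Definition kclass (gT : finGroupType) (K : fieldType) (G : {group gT})
    (phi : kfun gT K) : Prop :=
  (forall x, x \notin G -> phi x = 0) /\
  (forall x y, y \in G -> phi (x ^ y)%g = phi x).

(** The function [g |-> phi (g a)], where [phi] is extended linearly. *)
Definition gtrans (gT : finGroupType) (K : fieldType) (a : {ffun gT -> K})
    (phi : kfun gT K) : kfun gT K :=
  [ffun g => \sum_x a x * (phi (g * x)%g : K)].

Section ModularSystem.
Variables (p : nat) (O : idomainType) (K k : fieldType).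
Variables (iota : {rmorphism O -> K}) (res : {rmorphism O -> k}).
Hypothesis hOKk : modular_system p iota res.

Lemma modsys_natr_eq0 n : (n%:R == 0 :> K) = (n == 0)%N.
Proof. by case: hOKk => _ _ _ _ /pcharf0P. Qed.

Lemma modsys_card_neq0 (gT : finGroupType) (G : {group gT}) : #|G|%:R != 0 :> K.
Proof. by rewrite modsys_natr_eq0 -lt0n cardG_gt0. Qed.

(** A generator [pi] of the maximal ideal; the intersection of its powers is
    zero, as this intersection [I] is principal and satisfies [pi I = I]. *)
Lemma uniformizer_exists : exists2 pi : O, rdvd pi p%:R
  & (forall x, nonunits x <-> rdvd pi x) /\
    (forall x, (forall c, rdvd (pi ^+ c) x) -> x = 0).
Proof.
case: hOKk => _ dvr _ _ _ _ ker chk.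
have [pi defm] := dvr_principal dvr (dvr_local dvr).
have nuE x : nonunits x <-> rdvd pi x.
  by split; rewrite defm.
exists pi; first by apply/nuE/ker; rewrite rmorph_nat; case/andP: chk => _ /eqP.
split=> // x Hx.
have pi_neq0 : pi != 0.
  have [y y0 /nuE[d yE]] := dvr_nonfield dvr.
  by apply: contraNneq y0 => pi0; rewrite yE pi0 mulr0.
have pi_nu : pi \isn't a GRing.unit by apply/nuE; exists 1; rewrite mul1r.
pose I : set O := fun x => forall c, rdvd (pi ^+ c) x.
have I_id : is_ideal I.
  split=> [c|a y z Hy Hz c]; first exact: rdvd0.
  by apply: rdvdD => //; rewrite mulrC; apply: rdvdMr.
have [a defI] := dvr_principal dvr I_id.
have Ia : I a by rewrite defI; exists 1; rewrite mul1r.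
have [y ay] := Ia 1%N.
have [z yz] : rdvd a y.
  suff: I y by rewrite defI.
  move=> c; have [d ad] := Ia c.+1; exists d.
  by apply: (mulIf pi_neq0); rewrite -[pi in LHS]expr1 -ay ad -mulrA -exprSr.
have /eqP a0 : a == 0.
  have : a * (1 - z * pi) = 0.
    by rewrite mulrBr mulr1 {1}ay yz expr1 mulrAC [a * _]mulrC subrr.
  move/eqP; rewrite mulf_eq0 => /orP[//|]; rewrite subr_eq0 => /eqP e.
  by case/negP: pi_nu; apply/unitrP; exists z; rewrite [pi * z]mulrC -e.
have [d ->] : rdvd a x.
  by suff: I x by rewrite defI.
by rewrite a0 mulr0.
Qed.

Section OneGroup.
Variables (gT : finGroupType) (G : {group gT}).
Implicit Types (phi : kfun gT K) (f e b : {ffun gT -> O}).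

(** The trace of [g f] with respect to a class function with values in [K]
    vanishes, since the powers of the maximal ideal intersect in zero. *)
Lemma idem_trace_eq0 phi f g : kclass G phi -> g \in G ->
    in_galg G f -> gmul f f = f -> (forall x, f (x ^ g)%g = f x) ->
    (forall x, x \in 'C_G[g.`_p]%g -> nonunits (f x)) \/
    (forall v, v \in 'C_G[g.`_p]%g -> (p^').-elt v -> phi (g.`_p * v)%g = 0) ->
  \sum_x iota (f x) * (phi (g * x)%g : K) = 0.
Proof.
move=> [phiG phiJ] Gg fG f_idem f_inv Hor.
have [pi pi_p [nuE sep]] := uniformizer_exists.
have p_pr := modsys_prime hOKk.
(* The class function [phi] is a combination of the integral class functions
   [tau y], which are multiples of indicator functions of conjugacy classes. *)
pose tau y x : O := \sum_(z in G) (x == y ^ z)%g%:R.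
have tau0 y : phi y != 0 -> \sum_x f x * tau y (g * x)%g = 0.
  move=> phiy; apply: sep => c.
  apply: (@idem_trace_dvd _ _ p G) => //.
    move=> x z Gx Gz; rewrite /tau (reindex_inj (mulIg z)) /=.
    apply: eq_big => [t|t _]; first by rewrite groupMr.
    by rewrite conjgM (inj_eq (conjg_inj z)).
  case: Hor => [H|H]; [left=> x /H /nuE //|right=> v Cv v_p].
  rewrite /tau big1 // => z Gz; case: eqP => // E.
  by case/eqP: phiy; rewrite -(phiJ y z Gz) -E H.
apply: (mulfI (modsys_card_neq0 G)); rewrite mulr0.
transitivity (\sum_y (phi y : K) * iota (\sum_x f x * tau y (g * x)%g)).
  transitivity (\sum_y \sum_x \sum_(z in G) iota (f x) * ((phi y : K) * (g * x == y ^ z)%g%:R)); last first.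
    apply: eq_bigr => y _; rewrite rmorph_sum mulr_sumr; apply: eq_bigr => x _.
    rewrite /tau mulr_sumr rmorph_sum mulr_sumr; apply: eq_bigr => z _.
    by rewrite rmorphM rmorph_nat mulrCA.
  rewrite exchange_big mulr_sumr; apply: eq_bigr => x _ /=.
  rewrite exchange_big /= mulr_natl -sumr_const; apply: eq_bigr => z Gz.
  rewrite -mulr_sumr; congr (_ * _).
  rewrite (bigD1 ((g * x) ^ z^-1)%g) //= conjgKV eqxx mulr1 phiJ ?groupV //.
  rewrite big1 ?addr0 // => y; rewrite -(inj_eq (conjg_inj z)) conjgKV eq_sym.
  by move/negPf->; rewrite mulr0.
apply: big1 => y _; have [->|/tau0->] := eqVneq (phi y) 0; first exact: mul0r.
by rewrite rmorph0 mulr0.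
Qed.

Lemma p_singular_mul u v : u \in G -> v \in 'C_G[u]%g -> p.-elt u -> u != 1%g ->
  (p^').-elt v -> ~~ (p^').-elt (u * v)%g.
Proof.
move=> Gu; rewrite inE => /andP[Gv /cent1P cvu] pu u1 pv; apply: contra u1 => puv.
have : (p^').-elt (u * v * v^-1)%g.
  apply: p_eltM; rewrite ?p_eltV //.
  by apply/commute_sym/commuteM; [apply/commute_sym/commuteV/commute_sym| apply/commute_sym/commuteV; exact: commute_refl].
rewrite mulgK => pu'; rewrite -order_eq1; apply/eqP.
by apply: (@pnat_1 p); [exact: pu | exact: pu'].
Qed.

Lemma constt_mul_p u v : v \in 'C_G[u]%g -> p.-elt u -> (p^').-elt v -> (u * v)%g.`_p = u.
Proof.
rewrite inE => /andP[_ /cent1P cvu] pu pv.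
have v1 : (v.`_p = 1)%g by apply/constt1P.
rewrite consttM; last exact: commute_sym. by rewrite v1 mulg1 constt_p_elt.
Qed.

(** Central idempotents are supported on [p']-elements (Osima). *)
Lemma central_idem_p_regular e x : central_idem G e -> ~~ (p^').-elt x -> e x = 0.
Proof.
move=> [[eG cen] e_idem] px.
have [Gx|/eG//] := boolP (x \in G).
have eJ y z : z \in G -> e (y ^ z)%g = e y by apply: gcenterJ; split.
pose phi : kfun gT K := [ffun y => \sum_(z in G) (y == x ^ z)%g%:R].
have : \sum_y iota (e y) * (phi (1 * y)%g : K) = 0.
  apply: idem_trace_eq0 => //.
  - split=> [y nGy|y z Gz]; rewrite ffunE.
      by rewrite big1 // => z Gz; case: eqP => // yE; rewrite yE groupJ in nGy.
    rewrite ffunE (reindex_inj (mulIg z)) /=.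
    apply: eq_big => [t|t _]; first by rewrite groupMr.
    by rewrite conjgM (inj_eq (conjg_inj z)).
  - by move=> y; rewrite conjg1.
  right=> v _; rewrite constt1 mul1g => pv; rewrite ffunE big1 // => z Gz.
  case: eqP => // vE; move: pv; rewrite vE /p_elt orderJ => pv.
  by rewrite /p_elt pv in px.
under eq_bigr do rewrite mul1g ffunE mulr_sumr.
rewrite exchange_big /= => H.
have {H}: #|G|%:R * iota (e x) = 0.
  rewrite -H mulr_natl -sumr_const; apply: eq_bigr => z Gz.
  rewrite (bigD1 (x ^ z)%g) //= eqxx mulr1 eJ // big1 ?addr0 // => y /negPf->.
  exact: mulr0.
move/eqP; rewrite mulf_eq0 (negPf (modsys_card_neq0 G)) /= => /eqP H.
by apply: (modsys_inj hOKk); rewrite H rmorph0.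
Qed.

(** The projection of class functions to a sum of blocks preserves both the
    functions supported on [p']-elements and those vanishing on [p']-elements. *)
Lemma gtrans_p_regular e phi g : central_idem G e -> kclass G phi ->
    (forall x, (p^').-elt x = (p^').-elt g -> phi x = 0) ->
  gtrans (gmap iota e) phi g = 0.
Proof.
move=> [[eG cen] e_idem] phi_cl H; rewrite ffunE.
have [Gg|nGg] := boolP (g \in G); last first.
  rewrite big1 // => x _; have [Gx|nGx] := boolP (x \in G).
    by rewrite phi_cl.1 ?mulr0 // groupMr.
  by rewrite ffunE eG // rmorph0 mul0r.
under eq_bigr do rewrite ffunE.
apply: idem_trace_eq0 => //; first by move=> x; apply: (@gcenterJ _ _ G) => //; split.
right=> v Cv pv; apply: H.
have [pg|pg] := boolP ((p^').-elt g).
  by have /constt1P-> := pg; rewrite mul1g.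
apply/negbTE; apply: p_singular_mul pv => //; rewrite ?groupX ?p_elt_constt //.
by apply: contra pg => /eqP; move/constt1P.
Qed.

(** The decomposition map in terms of translation by the idempotent. *)
Lemma dec_mapE ue phi s : dec_map p iota G ue phi s =
  if (s \in 'C_G[ue.1]%g) && (p^').-elt s
  then gtrans (gmap iota ue.2) phi (ue.1 * s)%g else 0.
Proof.
rewrite ffunE; case: ifP => // _; rewrite /kfext sum_gmul.
transitivity (\sum_x gbasis K (ue.1 * s)%g x * gtrans (gmap iota ue.2) phi x).
  apply: eq_bigr => x _; rewrite [gtrans _ _ _]ffunE mulr_sumr; apply: eq_bigr => y _.
  by rewrite mulrA.
by rewrite sum_gbasis.
Qed.

(** Brauer's second main theorem: if [(u, e)] is not a Brauer element of [b],
    then [dec_map (u, e)] vanishes on the class functions of [b]. The trace is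
    that of [u s (b e)], and the coefficients of the idempotent [b e] vanish
    modulo the maximal ideal on the centraliser of [u]. *)
Lemma dec_map_not_brauer b u e phi :
    central_idem G b -> central_idem 'C_G[u] e -> u \in G -> p.-elt u ->
    gmul (brauer_map res G <[u]>%g b) (gmap res e) = 0 ->
    kclass G phi -> gtrans (gmap iota b) phi = phi ->
  dec_map p iota G (u, e) phi = 0.
Proof.
move=> [[bG bc] b_idem] [[eC ec] e_idem] Gu pu Br0 phi_cl phib.
apply/ffunP => s; rewrite dec_mapE /= [RHS]ffunE; case: ifP => [/andP[Cs ps]|//].
have Gs : s \in G by move: Cs; rewrite inE => /andP[].
have eG : in_galg G e by move=> x nGx; apply: eC; rewrite inE (negPf nGx).
transitivity (\sum_x iota (gmul b e x) * (phi (u * s * x)%g : K)).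
  rewrite (bc _ eG) -[in LHS]phib ffunE.
  transitivity (\sum_x (gmul (gmap iota e) (gmap iota b) x) * (phi (u * s * x)%g : K)).
    rewrite sum_gmul; apply: eq_bigr => y _; rewrite [gtrans _ _ _]ffunE mulr_sumr.
    by apply: eq_bigr => z _; rewrite mulrA mulgA.
  apply: eq_bigr => x _; congr (_ * _); rewrite !ffunE rmorph_sum.
  by apply: eq_bigr => y _; rewrite !ffunE rmorphM.
have usC : (u * s)%g \in 'C_G[u]%g by rewrite groupM // inE Gu cent1id.
apply: idem_trace_eq0 => //.
- by rewrite groupM.
- exact: gmul_galg.
- by rewrite gmulA -(gmulA b e) -(bc _ eG) gmulA b_idem -gmulA e_idem.
- move=> x; have bJ := gcenterJ _ (conj bG bc) (groupM Gu Gs).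
  have eJ := gcenterJ _ (conj eC ec) usC.
  rewrite !ffunE (reindex_inj (conjg_inj (u * s)%g)) /=; apply: eq_bigr => y _.
  by rewrite bJ -conjVg -conjMg eJ.
left=> x; rewrite (constt_mul_p Cs pu ps) => Cx; apply/(modsys_ker hOKk).
have /ffunP/(_ x) := Br0; rewrite ffunE [RHS]ffunE => Brx.
rewrite ffunE rmorph_sum -[RHS]Brx; apply: eq_bigr => y _.
rewrite !ffunE rmorphM cent_cycle; case: ifP => // nCy.
by rewrite eC ?rmorph0 ?mulr0 // groupMr // groupV nCy.
Qed.

End OneGroup.
End ModularSystem.

(** * Class functions act by scalars on irreducible modules *)
(** Classical existence may be used for propositional goals. *)
Lemma classicallyW (T : Type) (Q : Prop) : classically T -> (T -> Q) -> Q.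
Proof. by move=> H TQ; apply/asboolP/H => t; apply/asboolP/TQ. Qed.

Section TraceRoots.
Variables (F : fieldType) (m : nat) (w : F).
Hypothesis prim_w : (m.-primitive_root w)%R.

(** The trace of a matrix [A] with [A ^ m = 1] is a sum of [m]-th roots of unity.
    The hypothesis is stated by iteration so as to include matrices of size [0]. *)
Lemma mxtrace_unity_roots d (A : 'M[F]_d) :
    (forall B : 'M[F]_d, iter m (mulmx A) B = B) ->
  exists2 D : 'I_d -> F, \tr A = \sum_i D i & forall i, D i ^+ m = 1.
Proof.
case: d A => [|d] A Am; first by exists (fun=> 1) => [|i]; rewrite ?expr1n // /mxtrace !big_ord0.
have A1 : A ^+ m = 1.
  have H l : A ^+ l = iter l (mulmx A) 1%:M by elim: l => // l IH; rewrite exprS IH.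
  by rewrite H Am.
have /diagonalizableP : exists2 rs, uniq rs & mxminpoly A %| \prod_(x <- rs) ('X - x%:P).
  exists [seq w ^+ i | i <- index_iota 0 m].
    rewrite map_inj_in_uniq ?iota_uniq // => i j; rewrite !mem_index_iota => /andP[_ li] /andP[_ lj].
    by move/eqP; rewrite (eq_prim_root_expr prim_w) !modn_small // => /eqP.
  rewrite big_map (factor_Xn_sub_1 prim_w); apply: mxminpoly_min.
  by rewrite rmorphB rmorphXn /= horner_mx_X rmorph1 A1 subrr.
move=> [P Pu] /(diagonalizable_forLR Pu)[D AD].
have AE : A = invmx P *m diag_mx D *m P by rewrite AD mxpoly.conjumx ?unitmx_inv // invmxK.
exists (D 0) => [|i]; first by rewrite AE mxtrace_mulC mulmxA mulmxV // mul1mx mxtrace_diag.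
have DE : diag_mx D = P *m A *m invmx P.
  by rewrite AE !mulmxA mulmxV // mul1mx -mulmxA mulmxV // mulmx1.
have H1 l : diag_mx D ^+ l = P *m A ^+ l *m invmx P.
  elim: l => [|l IH]; first by rewrite mulmx1 mulmxV.
  rewrite exprSr IH DE exprSr !mulmxE -!mulrA; congr (_ * (_ * _)).
  by rewrite [invmx P * _]mulrA -[invmx P * P]/(invmx P *m P) mulVmx // mul1r.
have H2 l : diag_mx D ^+ l = diag_mx (\row_j D 0 j ^+ l).
  elim: l => [|l IH].
    by apply/matrixP => a b; rewrite !mxE expr0 eq_sym; case: eqP => // ->.
  rewrite exprSr IH -mulmxE mulmx_diag; congr diag_mx.
  by apply/rowP => j; rewrite !mxE exprSr.
have : diag_mx D ^+ m = 1 by rewrite H1 A1 mulmx1 mulmxV.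
by rewrite H2 => /matrixP/(_ i i); rewrite !mxE eqxx !mulr1n.
Qed.

End TraceRoots.
Lemma mxtrace_repr_roots (L : fieldType) (gT : finGroupType) (G : {group gT}) d
    (rG : mx_representation L G d) (m : nat) (w : L) x :
    (m.-primitive_root w)%R -> x \in G -> (#[x]%g %| m)%N ->
  exists2 D : 'I_d -> L, \tr (rG x) = \sum_i D i & forall i, D i ^+ #[x]%g = 1.
Proof.
move=> prim_w Gx dvm; apply: (mxtrace_unity_roots (dvdn_prim_root prim_w dvm)) => B.
have H l : iter l (mulmx (rG x)) B = rG (x ^+ l)%g *m B.
  elim: l => [|l IH]; first by rewrite repr_mx1 mul1mx.
  by rewrite iterS IH mulmxA -repr_mxM ?groupX // expgS.
by rewrite H expg_order repr_mx1 mul1mx.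
Qed.

Section Rext.
Variables (gT : finGroupType) (K : fieldType) (G : {group gT}).

(** The image of the group algebra element [a] under a representation. *)
Definition rext d (rG : mx_representation K G d) (a : gT -> K) : 'M[K]_d :=
  \sum_(x in G) a x *: rG x.

(** The character of a representation, extended by zero. *)
Definition rchar d (rG : mx_representation K G d) : kfun gT K :=
  [ffun x => (\tr (rG x)) *+ (x \in G)].

Lemma rcharE d (rG : mx_representation K G d) x : x \in G -> rchar rG x = \tr (rG x).
Proof. by move=> Gx; rewrite ffunE Gx. Qed.

Lemma rchar_kclass d (rG : mx_representation K G d) :
  (forall x, x \notin G -> rchar rG x = 0) /\
  (forall x y, y \in G -> rchar rG (x ^ y)%g = rchar rG x).
Proof.
split=> [x nGx|x y Gy]; first by rewrite ffunE (negPf nGx).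
rewrite !ffunE groupJr //; have [Gx|//] := boolP (x \in G).
rewrite !mulr1n conjgE !repr_mxM ?groupM ?groupV //.
by rewrite mxtrace_mulC -mulmxA -repr_mxM ?groupV // mulgV repr_mx1 mulmx1.
Qed.

Lemma mxtrace_rext d (rG : mx_representation K G d) a :
  \tr (rext rG a) = \sum_(x in G) a x * (rchar rG x : K).
Proof.
rewrite raddf_sum; apply: eq_bigr => x Gx /=.
by rewrite linearZ rcharE.
Qed.

Lemma rext_centg d (rG : mx_representation K G d) a :
  (forall x y, y \in G -> a (x ^ y)%g = a x) -> centgmx rG (rext rG a).
Proof.
move=> aJ; apply/centgmxP => y Gy; rewrite mulmx_suml mulmx_sumr.
rewrite [RHS](reindex_inj (conjg_inj y)) /=.
apply: eq_big => [x|x Gx]; first by rewrite groupJr.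
rewrite -scalemxAl -scalemxAr aJ // -!repr_mxM ?groupJ //.
by rewrite conjgE mulKVg.
Qed.

End Rext.

Section CentralScalar.
Variables (gT : finGroupType) (K : fieldType) (G : {group gT}) (n : nat) (z : K).
Hypothesis charK : [pchar K] =i pred0.
Hypotheses (prim_z : (n.-primitive_root z)%R) (dvG : (#|G| %| n)%N).

Lemma unity_root_image (L : fieldType) (j : {rmorphism K -> L}) m (w : L) :
  (m %| n)%N -> w ^+ m = 1 -> exists y, w = j y.
Proof.
move=> dvm wm; have wn : w ^+ n = 1 by case/dvdnP: dvm => q ->; rewrite mulnC exprM wm expr1n.
have jz : (n.-primitive_root (j z))%R by rewrite fmorph_primitive_root.
have [i ->] := prim_rootP jz wn.
by exists (z ^+ i); rewrite rmorphXn.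
Qed.

(** A class function acts by a scalar on an irreducible module, although [K] is
    not assumed to be a splitting field. Over a splitting extension [L] it has an
    eigenvalue on an irreducible submodule [V], equal to a trace divided by the
    dimension; characters take values in sums of roots of unity of [K], so the
    eigenvalue lies in [K] and Schur's lemma applies over [K]. *)
Lemma rext_scalar d (rG : mx_representation K G d) a :
    mx_irreducible rG -> (forall x y, y \in G -> a (x ^ y)%g = a x) ->
  exists w, rext rG a = w%:M.
Proof.
move=> irrG aJ; apply: (classicallyW (@group_splitting_field_exists gT G K)) => -[L j splL].
pose rL := map_repr j rG; have [d_gt0 _] := (mx_irrP rG).1 irrG.
have nz1 : (1%:M : 'M[L]_d) != 0 by rewrite -mxrank_eq0 mxrank1 -lt0n.
apply: (classicallyW (mxsimple_exists (mxmodule1 rL) nz1)) => -[V simV _].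
have [modV nzV _] := simV.
have irrV : mx_irreducible (submod_repr modV) by apply/submod_mx_irr.
have absV := splL _ _ irrV.
have aJ' x y : y \in G -> j (a (x ^ y)%g) = j (a x) by move=> Gy; rewrite aJ.
have /is_scalar_mxP[l Ml] := mx_abs_irr_cent_scalar absV (rext_centg (submod_repr modV) aJ').
have [r_gt0 _] := (mx_irrP _).1 irrV.
have charL m : (m%:R == 0 :> L) = (m == 0)%N.
  by rewrite -(rmorph_nat j) fmorph_eq0; move/pcharf0P: charK => ->.
have [k lk] : exists k, l = j k.
  have trE : l *+ \rank V = \sum_(x in G) j (a x) * (rchar (submod_repr modV) x : L).
    by rewrite -mxtrace_rext Ml mxtrace_scalar.
  have [t tE] : exists t, \sum_(x in G) j (a x) * (rchar (submod_repr modV) x : L) = j t.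
    elim/big_rec: _ => [|x _ Gx [t ->]]; first by exists 0; rewrite rmorph0.
    have jz : (n.-primitive_root (j z))%R by rewrite fmorph_primitive_root.
    have ox : (#[x]%g %| n)%N by apply: dvdn_trans dvG; apply: order_dvdG.
    have [D trD D1] := mxtrace_repr_roots (submod_repr modV) jz Gx ox.
    have [c cE] : exists c, \sum_i D i = j c.
      elim/big_rec: _ => [|i _ _ [c ->]]; first by exists 0; rewrite rmorph0.
      have [y ->] := unity_root_image j ox (D1 i).
      by exists (y + c); rewrite rmorphD.
    by exists (a x * c + t); rewrite rmorphD rmorphM rcharE // trD cE.
  exists (t / (\rank V)%:R); rewrite fmorph_div /= rmorph_nat -tE -trE.
  by rewrite -[l *+ _]mulr_natr mulfK // charL -lt0n.
exists k; apply/eqP; rewrite -subr_eq0; apply/negP => /negP nz.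
have cen : centgmx rG (rext rG a - k%:M).
  apply/centgmxP => y Gy; rewrite mulmxBl mulmxBr; congr (_ - _).
    by have /centgmxP-> := rext_centg rG aJ.
  by rewrite scalar_mxC.
have := mx_Schur irrG cen nz; rewrite -(map_unitmx j) => un.
case/negP: nzV; rewrite -[V](mulmxK un) (_ : V *m _ = 0) ?mul0mx //.
have VE x : x \in G -> val_submod 1%:M *m rL x = val_submod (submod_repr modV x).
  by move=> Gx; rewrite -val_submodJ // mul1mx.
have kill : val_submod (1%:M : 'M_(\rank V)) *m map_mx j (rext rG a - k%:M) = 0.
  rewrite map_mxB map_scalar_mx -lk mulmxBr mul_mx_scalar.
  have -> : map_mx j (rext rG a) = \sum_(x in G) j (a x) *: rL x.
    by rewrite raddf_sum; apply: eq_bigr => x Gx; rewrite /= map_mxZ.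
  have -> : val_submod (1%:M : 'M_(\rank V)) *m (\sum_(x in G) j (a x) *: rL x) =
      val_submod (rext (submod_repr modV) (fun x => j (a x))).
    rewrite mulmx_sumr linear_sum; apply: eq_bigr => x Gx.
    by rewrite [RHS]linearZ /= -VE // scalemxAr.
  by rewrite Ml -(scalemx1 _ l) [X in X - _]linearZ /= subrr.
have /submxP[X ->] : (V <= val_submod (1%:M : 'M_(\rank V)))%MS by rewrite val_submod1.
by rewrite -mulmxA kill mulmx0.
Qed.

End CentralScalar.

(** * Orthogonality and completeness of irreducible characters *)
Section Orthogonality.
Variables (gT : finGroupType) (K : fieldType) (G : {group gT}).
Hypothesis charK : [pchar K] =i pred0.

Lemma pchar0_natr_eq0 m : (m%:R == 0 :> K) = (m == 0)%N.
Proof. by move/pcharf0P: charK => ->. Qed.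

Lemma pchar0_card_neq0 : #|G|%:R != 0 :> K.
Proof. by rewrite pchar0_natr_eq0 -lt0n cardG_gt0. Qed.

Lemma mul_delta_diag d1 d2 (A : 'M[K]_d1) (B : 'M[K]_d2) i k :
  (A *m delta_mx i k *m B) i k = A i i * B k k.
Proof.
rewrite mxE (bigD1 k) //= big1 => [|l nlk]; last first.
  by rewrite !mxE big1 ?mul0r // => m _; rewrite !mxE (negPf nlk) andbF mulr0.
rewrite addr0 mxE (bigD1 i) //= big1 ?addr0 => [|m nmi]; last first.
  by rewrite !mxE (negPf nmi) mulr0.
by rewrite !mxE !eqxx mulr1.
Qed.

Lemma mxtrace_mul_delta d1 d2 (A : 'M[K]_d1) (B : 'M[K]_d2) :
  \sum_i \sum_k (A *m delta_mx i k *m B) i k = \tr A * \tr B.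
Proof.
rewrite mulr_suml; apply: eq_bigr => i _; rewrite mulr_sumr.
by apply: eq_bigr => k _; rewrite mul_delta_diag.
Qed.

Lemma kfdotC (phi psi : kfun gT K) : kfdot G phi psi = kfdot G psi phi.
Proof.
rewrite /kfdot; congr (_ * _); rewrite (reindex_inj invg_inj) /=.
by apply: eq_big => [x|x _]; rewrite ?groupV // invgK mulrC.
Qed.

Lemma kfdotDl (phi1 phi2 psi : kfun gT K) :
  kfdot G (phi1 + phi2) psi = kfdot G phi1 psi + kfdot G phi2 psi.
Proof.
rewrite /kfdot -mulrDr; congr (_ * _); rewrite -big_split.
by apply: eq_bigr => x _ /=; rewrite ffunE mulrDl.
Qed.

Lemma kfdotZl c (phi psi : kfun gT K) : kfdot G (c *: phi) psi = c * kfdot G phi psi.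
Proof.
rewrite /kfdot [RHS]mulrCA; congr (_ * _); rewrite mulr_sumr.
by apply: eq_bigr => x _ /=; rewrite ffunE /= -mulrA.
Qed.

Lemma kfdot_suml (T : Type) (s : seq T) (c : T -> K) (F : T -> kfun gT K) psi :
  kfdot G (\sum_(i <- s) c i *: F i) psi = \sum_(i <- s) c i * kfdot G (F i) psi.
Proof.
elim: s => [|i s IH].
  rewrite !big_nil /kfdot big1 ?mulr0 // => x _; rewrite ffunE; exact: mul0r.
by rewrite !big_cons kfdotDl kfdotZl IH.
Qed.

Lemma rsim_of_intertwiner d1 d2 (rG1 : mx_representation K G d1)
    (rG2 : mx_representation K G d2) (Y : 'M[K]_(d1, d2)) :
    mx_irreducible rG1 -> mx_irreducible rG2 -> Y != 0 ->
    (forall x, x \in G -> rG1 x *m Y = Y *m rG2 x) ->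
  rchar rG1 = rchar rG2.
Proof.
move=> /mx_irrP[d1_gt0 irr1] /mx_irrP[d2_gt0 irr2] nzY tw.
have kerY : mxmodule rG1 (kermx Y).
  apply/mxmoduleP => x Gx; apply/sub_kermxP.
  by rewrite -mulmxA tw // mulmxA mulmx_ker mul0mx.
have freeY : row_free Y.
  rewrite -kermx_eq0; apply: contraNT nzY => nz.
  have full := irr1 _ kerY nz; have /submxP[X X1] : (1%:M <= kermx Y)%MS by rewrite sub1mx.
  by rewrite -[Y]mul1mx X1 -mulmxA mulmx_ker mulmx0.
have imY : mxmodule rG2 <<Y>>%MS.
  apply/mxmoduleP => x Gx; rewrite genmxE (eqmxMr _ (genmxE Y)) -tw //.
  exact: submxMl.
have fullY : row_full Y.
  rewrite /row_full -(genmxE Y); apply: irr2 => //.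
  by rewrite -mxrank_eq0 genmxE mxrank_eq0.
have e12 : d1 = d2 by rewrite -(eqP freeY) (eqP fullY).
apply/ffunP => x; rewrite !ffunE; have [Gx|//] := boolP (x \in G).
by congr (_ *+ _); apply: (@mxtrace_rsim K) Gx; exists Y.
Qed.

Lemma avg_intertwines d1 d2 (rG1 : mx_representation K G d1)
    (rG2 : mx_representation K G d2) X y : y \in G ->
  rG1 y *m (\sum_(x in G) rG1 x^-1%g *m X *m rG2 x) =
  (\sum_(x in G) rG1 x^-1%g *m X *m rG2 x) *m rG2 y.
Proof.
move=> Gy; rewrite mulmx_suml mulmx_sumr (reindex_inj (mulIg y)) /=.
apply: eq_big => [x|x]; rewrite groupMr // => Gx.
rewrite !mulmxA -repr_mxM ?groupV ?groupM // invMg mulKVg.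
by rewrite -[RHS]mulmxA -repr_mxM.
Qed.

(** Averaging the matrix units gives intertwiners, which vanish. *)
Lemma irr_orthogonal d1 d2 (rG1 : mx_representation K G d1)
    (rG2 : mx_representation K G d2) :
    mx_irreducible rG1 -> mx_irreducible rG2 -> rchar rG1 <> rchar rG2 ->
  kfdot G (rchar rG1) (rchar rG2) = 0.
Proof.
move=> irr1 irr2 ne; rewrite kfdotC /kfdot.
rewrite (_ : \sum_(x in G) _ = 0) ?mulr0 //.
transitivity (\sum_i \sum_k (\sum_(x in G) rG1 x^-1%g *m delta_mx i k *m rG2 x) i k).
  under [RHS]eq_bigr => i _ do under eq_bigr => k _ do rewrite summxE.
  under [RHS]eq_bigr => i _ do rewrite exchange_big.
  rewrite exchange_big; apply: eq_bigr => x Gx /=.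
  by rewrite mxtrace_mul_delta mulrC !rcharE ?groupV.
apply: big1 => i _; apply: big1 => k _.
have [->|nz] := eqVneq (\sum_(x in G) rG1 x^-1%g *m delta_mx i k *m rG2 x) 0.
  by rewrite mxE.
by case: ne; apply: rsim_of_intertwiner nz _ => // y; exact: avg_intertwines.
Qed.

Lemma mxtrace_idem n (P : 'M[K]_n) : P *m P = P -> \tr P = (\rank P)%:R.
Proof.
have H r (C : 'M[K]_(n, r)) (B : 'M[K]_(r, n)) L R :
    L *m C = 1%:M -> B *m R = 1%:M -> C *m B *m (C *m B) = C *m B -> B *m C = 1%:M.
  move=> LC BR e; have : L *m (C *m B *m (C *m B)) *m R = L *m (C *m B) *m R by rewrite e.
  by rewrite !mulmxA LC !mul1mx -!mulmxA BR mulmx1.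
move=> PP; rewrite -{1}(mulmx_base P) mxtrace_mulC.
have [L LC] := row_fullP (col_base_full P).
have [R RB] := row_freeP (row_base_free P).
by rewrite (H _ _ _ _ _ LC RB) ?mxtrace1 // mulmx_base.
Qed.

(** The norm of an irreducible character is the rank of the projector
    [X |-> |G|^-1 * \sum_x x^-1 X x] to the commutant. *)
Lemma irr_norm d (rG : mx_representation K G d) : mx_irreducible rG ->
  exists2 r : nat, (0 < r)%N & kfdot G (rchar rG) (rchar rG) = r%:R.
Proof.
move=> irr; have [d_gt0 _] := (mx_irrP rG).1 irr.
pose avg (X : 'M[K]_d) := #|G|%:R^-1 *: \sum_(x in G) rG x^-1%g *m X *m rG x.
pose P : 'M[K]_(d * d) := #|G|%:R^-1 *: \sum_(x in G) lin_mx (mulmxr (rG x) \o mulmx (rG x^-1%g)).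
have PE X : mxvec X *m P = mxvec (avg X).
  rewrite -scalemxAr mulmx_sumr [RHS]linearZ /=; congr (_ *: _); rewrite linear_sum.
  by apply: eq_bigr => x _; rewrite mul_vec_lin.
have avg_id X : (forall x, x \in G -> rG x *m X = X *m rG x) -> avg X = X.
  move=> cX; rewrite /avg (eq_bigr (fun=> X)) => [|x Gx]; last first.
    by rewrite -mulmxA -cX // mulmxA -repr_mxM ?groupV // mulVg repr_mx1 mul1mx.
  by rewrite sumr_const -scaler_nat scalerA mulVf ?scale1r ?pchar0_card_neq0.
have avgP X x : x \in G -> rG x *m avg X = avg X *m rG x.
  by move=> Gx; rewrite /avg -scalemxAr -scalemxAl avg_intertwines.
have PP : P *m P = P.
  apply/row_matrixP => i; rewrite !rowE mulmxA -[delta_mx 0 i]vec_mxK !PE.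
  by rewrite avg_id // => x; exact: avgP.
exists (\rank P).
  rewrite lt0n mxrank_eq0; apply: contraTneq d_gt0 => P0.
  have : avg 1%:M = 1%:M by apply: avg_id => x _; rewrite mulmx1 mul1mx.
  have -> : avg 1%:M = 0 by apply: (can_inj mxvecK); rewrite -PE P0 mulmx0 linear0.
  by move/esym/eqP; rewrite -mxrank_eq0 mxrank1 => /eqP->.
rewrite -(mxtrace_idem PP) /kfdot linearZ /=; congr (_ * _).
rewrite raddf_sum; apply: eq_bigr => x Gx /=.
rewrite !rcharE ?groupV // mulrC -mxtrace_mul_delta /mxtrace.
rewrite pair_bigA [RHS](reindex _ (curry_mxvec_bij _ _)) /=.
apply: eq_bigr => -[i k] _ /=; set L := lin_mx _.
have -> : L (mxvec_index i k) (mxvec_index i k) = row (mxvec_index i k) L 0 (mxvec_index i k).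
  by rewrite [RHS]mxE.
by rewrite rowE -mxvec_delta mul_vec_lin mxvecE.
Qed.

End Orthogonality.
Section Completeness.
Variables (gT : finGroupType) (K : fieldType) (G : {group gT}) (n : nat) (z : K).
Hypothesis charK : [pchar K] =i pred0.
Hypotheses (prim_z : (n.-primitive_root z)%R) (dvG : (#|G| %| n)%N).

Lemma pchar0_group : [pchar K]^'.-group G.
Proof. by apply/pnatP => // q _ _; rewrite inE /= charK. Qed.

(** The regular representation is faithful on the group algebra. *)
Lemma rext_regular_eq0 (a : gT -> K) x :
  rext (regular_repr K G) a = 0 -> x \in G -> a x = 0.
Proof.
move=> a0 Gx; have /rowP/(_ (gring_index G x)) : row (gring_index G 1%g) (rext (regular_repr K G) a) = 0.
  by rewrite a0 row0.
rewrite [RHS]mxE /rext linear_sum summxE (bigD1 x) //= big1 ?addr0 => [|y /andP[Gy nyx]].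
  by rewrite linearZ /= rowK gring_indexK // mul1g !mxE !eqxx mulr1.
rewrite linearZ /= rowK gring_indexK // mul1g !mxE eqxx /=.
rewrite [_ == _]negbTE ?mulr0 //; apply: contraNneq nyx => /(congr1 enum_val).
by rewrite !gring_indexK // => ->.
Qed.

(** By Maschke's theorem an element that kills all irreducible modules is zero. *)
Lemma rext_irr_eq0 (a : gT -> K) x :
    (forall d (rG : mx_representation K G d), mx_irreducible rG -> rext rG a = 0) ->
  x \in G -> a x = 0.
Proof.
move=> a0; apply: rext_regular_eq0; set aG := regular_repr K G.
have red := mx_Maschke_pchar aG pchar0_group.
apply: (classicallyW (mx_reducible_semisimple (mxmodule1 aG) red)) => -[I U W simU defW _].
have kill i : U i *m rext aG a = 0.
  have [modU _ _] := simU i.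
  have irrU : mx_irreducible (submod_repr modU) by apply/submod_mx_irr.
  have kill1 : val_submod (1%:M : 'M_(\rank (U i))) *m rext aG a = 0.
    transitivity (val_submod (rext (submod_repr modU) a)).
      rewrite mulmx_sumr linear_sum; apply: eq_bigr => y Gy.
      by rewrite [RHS]linearZ /= -[submod_mx _ _]mul1mx val_submodJ // scalemxAr.
    by rewrite a0 // linear0.
  have /submxP[X ->] : (U i <= val_submod (1%:M : 'M_(\rank (U i))))%MS by rewrite val_submod1.
  by rewrite -mulmxA kill1 mulmx0.
have /sub_kermxP : (1%:M <= kermx (rext aG a))%MS.
  by rewrite -defW; apply/sumsmx_subP => i _; apply/sub_kermxP.
by rewrite mul1mx.
Qed.

(** The irreducible [K]-characters of [G]. *)
Definition irrchar (chi : kfun gT K) : Prop :=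
  exists d (rG : mx_representation K G d), mx_irreducible rG /\ chi = rchar rG.

Lemma kclass_orthogonal_eq0 (phi : kfun gT K) :
    (forall x, x \notin G -> phi x = 0) ->
    (forall x y, y \in G -> phi (x ^ y)%g = phi x) ->
    (forall chi, irrchar chi -> kfdot G phi chi = 0) ->
  phi = 0.
Proof.
move=> phi0 phiJ orth; apply/ffunP => x; rewrite [RHS]ffunE.
have [Gx|/phi0//] := boolP (x \in G).
rewrite -[x]invgK; apply: (@rext_irr_eq0 (fun x => phi x^-1%g)); last by rewrite groupV.
move=> d rG irr.
have [w rw] := rext_scalar charK prim_z dvG irr (fun y t Gt => etrans (congr1 phi (esym (conjVg y t))) (phiJ y^-1%g t Gt)).
have [d_gt0 _] := (mx_irrP rG).1 irr.
suff w0 : w = 0 by rewrite rw w0 raddf0.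
have := mxtrace_rext rG (fun x => phi x^-1%g); rewrite rw mxtrace_scalar.
have := orth _ (ex_intro _ d (ex_intro _ rG (conj irr erefl))).
move/eqP; rewrite kfdotC /kfdot mulf_eq0 invr_eq0 (negPf (pchar0_card_neq0 G charK)) /=.
under eq_bigr do rewrite mulrC.
move/eqP=> -> /eqP; rewrite -mulr_natr mulf_eq0 pchar0_natr_eq0 //.
by rewrite (gtn_eqF d_gt0) orbF => /eqP.
Qed.

Lemma irrchar_finite : exists s : seq (kfun gT K),
  uniq s /\ forall chi, chi \in s <-> irrchar chi.
Proof.
apply: (classicallyW (socle_exists (regular_repr K G))) => sG.
pose ch (i : sG) := rchar (irr_repr i).
exists (undup [seq chi <- codom ch | `[< irrchar chi >]]); split; first exact: undup_uniq.
move=> chi; rewrite mem_undup mem_filter; split=> [/andP[/asboolP]//|Ichi].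
apply/andP; split; first exact/asboolP.
case: Ichi => d [rG [irr ->]].
have sim := rsim_irr_comp_pchar sG pchar0_group irr.
apply/codomP; exists (irr_comp sG rG); apply/ffunP => x; rewrite !ffunE.
by have [Gx|//] := boolP (x \in G); rewrite !mulr1n; apply: (@mxtrace_rsim K) Gx.
Qed.

Lemma irrchar_orth chi psi : irrchar chi -> irrchar psi -> chi <> psi -> kfdot G chi psi = 0.
Proof. by move=> [d1 [r1 [i1 ->]]] [d2 [r2 [i2 ->]]]; exact: irr_orthogonal. Qed.

Lemma irrchar_norm chi : irrchar chi -> exists2 r : nat, (0 < r)%N & kfdot G chi chi = r%:R.
Proof. by move=> [d [rG [irr ->]]]; exact: irr_norm. Qed.

End Completeness.

(** * The characters of a block *)
Section Gtrans.
Variables (gT : finGroupType) (K : fieldType).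
Implicit Types (a c : {ffun gT -> K}) (phi psi : kfun gT K).

Lemma gtrans_gtrans a c phi : gtrans a (gtrans c phi) = gtrans (gmul a c) phi.
Proof.
apply/ffunP => g; rewrite [RHS]ffunE [LHS]ffunE.
rewrite (sum_gmul a c (fun x => phi (g * x)%g : K)).
apply: eq_bigr => x _; rewrite ffunE mulr_sumr; apply: eq_bigr => y _.
by rewrite mulrA mulgA.
Qed.

Lemma gtransDl a c phi : gtrans (a + c) phi = gtrans a phi + gtrans c phi.
Proof.
apply/ffunP => g; rewrite !ffunE -big_split; apply: eq_bigr => x _ /=.
by rewrite ffunE mulrDl.
Qed.

Lemma gtrans_sum (T : Type) (s : seq T) (m : T -> K) (F : T -> kfun gT K) a :
  gtrans a (\sum_(i <- s) m i *: F i) = \sum_(i <- s) m i *: gtrans a (F i).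
Proof.
elim: s => [|i s IH].
  rewrite !big_nil; apply/ffunP => g; rewrite !ffunE big1 // => x _.
  by rewrite ffunE; exact: mulr0.
rewrite !big_cons -IH; apply/ffunP => g; rewrite !ffunE /GRing.scale /= mulr_sumr -big_split.
by apply: eq_bigr => x _ /=; rewrite !ffunE /= mulrDr mulrCA.
Qed.

Lemma kclass_sum G (T : eqType) (s : seq T) (m : T -> K) (F : T -> kfun gT K) :
  (forall i, i \in s -> kclass G (F i)) -> kclass G (\sum_(i <- s) m i *: F i).
Proof.
move=> H; split=> [x nGx|x y Gy].
  by rewrite sum_ffunE big_seq big1 // => i si; rewrite ffunE (H i si).1 // scaler0.
rewrite !sum_ffunE; apply: eq_big_seq => i si.
by rewrite !ffunE (H i si).2.
Qed.

Lemma kclassB G phi psi : kclass G phi -> kclass G psi -> kclass G (phi - psi).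
Proof.
move=> [H1 H2] [H3 H4]; split=> [x nGx|x y Gy]; rewrite !ffunE.
  by rewrite H1 // H3 // subrr.
by rewrite H2 // H4.
Qed.

End Gtrans.

Section BlockCharacters.
Variables (p : nat) (O : idomainType) (K k : fieldType).
Variables (iota : {rmorphism O -> K}) (res : {rmorphism O -> k}).
Hypothesis hOKk : modular_system p iota res.
Variables (gT : finGroupType) (G : {group gT}) (n : nat) (z : K).
Hypotheses (prim_z : (n.-primitive_root z)%R) (dvG : (#|G| %| n)%N).
Let charK := modsys_charK hOKk.
Implicit Types (b e f : {ffun gT -> O}) (phi chi : kfun gT K).

Lemma gmap_gmul e f : gmap iota (gmul e f) = gmul (gmap iota e) (gmap iota f).
Proof.
apply/ffunP => x; rewrite !ffunE rmorph_sum; apply: eq_bigr => y _.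
by rewrite !ffunE rmorphM.
Qed.

Lemma gmapD e f : gmap iota (e + f) = gmap iota e + gmap iota f.
Proof. by apply/ffunP => x; rewrite !ffunE rmorphD. Qed.

Lemma rext_gmul d (rG : mx_representation K G d) (a c : {ffun gT -> K}) :
  in_galg G a -> in_galg G c -> rext rG (gmul a c) = rext rG a *m rext rG c.
Proof.
move=> aG cG; rewrite /rext mulmx_suml.
transitivity (\sum_(x in G) \sum_(y in G) (a y * c (y^-1 * x)%g) *: rG x).
  apply: eq_bigr => x Gx; rewrite ffunE scaler_suml (bigID (mem G)) /= addrC big1 ?add0r //.
  by move=> y nGy; rewrite aG // mul0r scale0r.
rewrite exchange_big; apply: eq_bigr => y Gy /=.
rewrite mulmx_sumr (reindex_inj (mulgI y)) /=.
apply: eq_big => [x|x]; rewrite groupMl // => Gx.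
by rewrite mulKg repr_mxM // -scalemxAl -scalemxAr scalerA.
Qed.

Lemma gtrans_rchar d (rG : mx_representation K G d) (a : {ffun gT -> K}) g :
  in_galg G a -> g \in G -> gtrans a (rchar rG) g = \tr (rG g *m rext rG a).
Proof.
move=> aG Gg; rewrite ffunE mulmx_sumr raddf_sum (bigID (mem G)) /= addrC big1 ?add0r.
  by apply: eq_bigr => x Gx; rewrite rcharE ?groupM // repr_mxM // -scalemxAr linearZ.
by move=> x nGx; rewrite aG // mul0r.
Qed.

Lemma gmap_galg e : in_galg G e -> in_galg G (gmap iota e).
Proof. by move=> eG x nGx; rewrite ffunE eG // rmorph0. Qed.

Lemma rext_central_idem d (rG : mx_representation K G d) e :
    mx_irreducible rG -> central_idem G e ->
  rext rG (gmap iota e) = 0 \/ rext rG (gmap iota e) = 1%:M.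
Proof.
move=> irr [[eG ec] e_idem].
have eJ x y : y \in G -> gmap iota e (x ^ y)%g = gmap iota e x.
  by move=> Gy; rewrite !ffunE (@gcenterJ _ _ G).
have [w rw] := rext_scalar charK prim_z dvG irr eJ.
have [d_gt0 _] := (mx_irrP rG).1 irr.
have := rext_gmul rG (gmap_galg eG) (gmap_galg eG).
rewrite -gmap_gmul e_idem rw -scalar_mxM => /matrixP/(_ (Ordinal d_gt0) (Ordinal d_gt0)).
rewrite !mxE !eqxx !mulr1n => /eqP; rewrite eq_sym -subr_eq0 -{3}[w]mulr1 -mulrBr mulf_eq0 subr_eq0.
by case/orP=> /eqP->; [left; rewrite raddf0|right].
Qed.

Lemma gtrans_kclass0 e phi x : in_galg G e -> kclass G phi -> x \notin G ->
  gtrans (gmap iota e) phi x = 0.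
Proof.
move=> eG phi_cl nGx; rewrite ffunE big1 // => y _.
have [Gy|nGy] := boolP (y \in G); last by rewrite ffunE eG // rmorph0 mul0r.
by rewrite phi_cl.1 ?mulr0 // groupMr.
Qed.

Lemma irrchar_kclass chi : irrchar G chi -> kclass G chi.
Proof. by move=> [d [rG [_ ->]]]; exact: rchar_kclass. Qed.

Lemma irrchar_neq0 chi : irrchar G chi -> chi != 0.
Proof.
move=> Ichi; have [r r_gt0 nr] := irrchar_norm charK Ichi.
apply: contraTneq r_gt0 => chi0; rewrite -eqn0Ngt -(pchar0_natr_eq0 charK) -nr chi0.
by rewrite /kfdot big1 ?mulr0 // => x _; rewrite ffunE; exact: mul0r.
Qed.

Lemma Irr_irrchar b chi : Irr iota G b chi -> irrchar G chi.
Proof. by move=> [d [rG [irr _ ->]]]; exists d, rG. Qed.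

Lemma rext_gmap d (rG : mx_representation K G d) b :
  rext rG (gmap iota b) = \sum_(x in G) iota (b x) *: rG x.
Proof. by apply: eq_bigr => x _; rewrite ffunE. Qed.

(** Each irreducible character either belongs to the block, or is killed by its
    idempotent. *)
Lemma irrchar_block b chi : central_idem G b -> irrchar G chi ->
  (Irr iota G b chi /\ gtrans (gmap iota b) chi = chi) \/
  (~ Irr iota G b chi /\ gtrans (gmap iota b) chi = 0).
Proof.
move=> bc Ichi; have chi0 := irrchar_neq0 Ichi; have bG := bc.1.1.
have gt1 d (rG : mx_representation K G d) : rext rG (gmap iota b) = 1%:M ->
    gtrans (gmap iota b) (rchar rG) = rchar rG.
  move=> r1; apply/ffunP => x; have [Gx|nGx] := boolP (x \in G).
    by rewrite gtrans_rchar ?r1 ?mulmx1 ?rcharE //; exact: gmap_galg.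
  by rewrite gtrans_kclass0 // ?(rchar_kclass rG).1 //; exact: rchar_kclass.
case: Ichi => d [rG [irr chiE]]; case: (rext_central_idem irr bc) => r.
  have gt0 : gtrans (gmap iota b) chi = 0.
    rewrite chiE; apply/ffunP => x; rewrite [RHS]ffunE.
    have [Gx|nGx] := boolP (x \in G); last by rewrite gtrans_kclass0 //; exact: rchar_kclass.
    by rewrite gtrans_rchar ?r ?mulmx0 ?mxtrace0 //; exact: gmap_galg.
  right; split=> // -[d' [rG' [irr' r1 chi']]].
  have := gt1 _ rG'; rewrite rext_gmap r1 => /(_ erefl).
  by move/eqP: chi0; rewrite chi' -[X in X <> _]/(rchar rG') => + e; rewrite -e -[rchar _]chi' gt0.
left; split; last by rewrite chiE gt1.
by exists d, rG; split=> //; rewrite -rext_gmap.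
Qed.

Lemma Irr_gtrans b chi : central_idem G b -> Irr iota G b chi -> gtrans (gmap iota b) chi = chi.
Proof. by move=> bc Ichi; case: (irrchar_block bc (Irr_irrchar Ichi)) => -[]. Qed.

Lemma Irr_finite b : exists2 s : seq (kfun gT K), uniq s & forall chi, chi \in s <-> Irr iota G b chi.
Proof.
have [s [us sE]] := irrchar_finite G charK.
exists [seq chi <- s | `[< Irr iota G b chi >]]; first exact: filter_uniq.
move=> chi; rewrite mem_filter; split=> [/andP[/asboolP]//|Ichi].
by apply/andP; split; [exact/asboolP | apply/sE; exact: Irr_irrchar Ichi].
Qed.

(** The [K]-span of [Irr(B)] described as a space of class functions. *)
Definition block_cf b phi := kclass G phi /\ gtrans (gmap iota b) phi = phi.

Lemma kclass_expand phi (s : seq (kfun gT K)) : uniq s ->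
    (forall chi, chi \in s <-> irrchar G chi) -> kclass G phi ->
  phi = \sum_(chi <- s) (kfdot G phi chi / kfdot G chi chi) *: chi.
Proof.
move=> us sE phi_cl; set psi := \sum_(chi <- s) _.
have psi_cl : kclass G psi.
  by apply: kclass_sum => chi /sE; exact: irrchar_kclass.
have [d0 dJ] := kclassB phi_cl psi_cl.
apply/eqP; rewrite -subr_eq0; apply/eqP.
apply: (kclass_orthogonal_eq0 charK prim_z dvG) => // chi Ichi.
have sc := (sE chi).2 Ichi.
rewrite kfdotDl -scaleN1r kfdotZl mulN1r; apply/eqP; rewrite subr_eq0; apply/eqP.
rewrite kfdot_suml (bigD1_seq chi) //= big_seq_cond big1 ?addr0.
  have [r r_gt0 nr] := irrchar_norm charK Ichi.
  by rewrite mulfVK // nr pchar0_natr_eq0 // -lt0n.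
move=> eta /andP[/sE Ie ne]; rewrite (irrchar_orth Ie Ichi) ?mulr0 //.
exact/eqP.
Qed.

Lemma block_cf_expand b phi (s : seq (kfun gT K)) : central_idem G b -> uniq s ->
    (forall chi, chi \in s <-> Irr iota G b chi) -> block_cf b phi ->
  phi = \sum_(chi <- s) (kfdot G phi chi / kfdot G chi chi) *: chi.
Proof.
move=> bc us sE [phi_cl phib].
have [t [ut tE]] := irrchar_finite G charK.
rewrite -{1}phib {1}(kclass_expand ut tE phi_cl) gtrans_sum.
rewrite (bigID (mem s)) /= [X in _ + X]big_seq_cond [X in _ + X]big1 => [|chi /andP[/tE Ic nsc]].
  rewrite addr0 -big_filter (perm_big s) /=.
    by apply: eq_big_seq => chi /sE Ic; rewrite Irr_gtrans.
  apply: uniq_perm => //; first exact: filter_uniq.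
  move=> chi; rewrite mem_filter; have [sc|//] := boolP (chi \in s).
  by apply/tE/Irr_irrchar/sE.
case: (irrchar_block bc Ic) => -[Ib ->]; last by rewrite scaler0.
by case/negP: nsc; apply/sE.
Qed.

Lemma block_cf_sum b (T : eqType) (s : seq T) (m : T -> K) (F : T -> kfun gT K) :
  (forall i, i \in s -> block_cf b (F i)) -> block_cf b (\sum_(i <- s) m i *: F i).
Proof.
move=> H; split; first by apply: kclass_sum => i /H[].
by rewrite gtrans_sum; apply: eq_big_seq => i /H[_ ->].
Qed.

Lemma Irr_block_cf b chi : central_idem G b -> Irr iota G b chi -> block_cf b chi.
Proof. by move=> bc Ic; split; [apply/irrchar_kclass/Irr_irrchar/Ic | exact: Irr_gtrans]. Qed.

Lemma zspan_block_cf b phi : central_idem G b -> zspan (Irr iota G b) phi -> block_cf b phi.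
Proof.
move=> bc [m [c [x [Ix ->]]]].
rewrite (eq_bigr (fun i => (c i)%:~R *: x i)) => [|i _]; last by rewrite scaler_int.
by apply: block_cf_sum => i _; apply: Irr_block_cf.
Qed.

Lemma block_cf_kspan b phi : central_idem G b -> block_cf b phi -> kspan (Irr iota G b) phi.
Proof.
move=> bc bphi; have [s us sE] := Irr_finite b.
exists (size s), (fun i => kfdot G phi s`_i / kfdot G s`_i s`_i), (fun i => s`_i).
split; first by move=> i; apply/sE; exact: mem_nth.
by rewrite [LHS](block_cf_expand bc us sE bphi) (big_nth 0) big_mkord.
Qed.

Lemma Irr_zspan b chi : Irr iota G b chi -> zspan (Irr iota G b) chi.
Proof.
move=> Ic; exists 1%N, (fun=> 1), (fun=> chi); split=> //.
by rewrite big_ord1 mulr1z.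
Qed.

(** Every central idempotent is a sum of blocks, by induction on the number of
    irreducible characters that it does not kill. *)
Lemma central_idem_sum_blocks e : central_idem G e ->
  exists2 es : seq {ffun gT -> O}, (forall f, f \in es -> is_block G f) & e = \sum_(f <- es) f.
Proof.
have [s [us sE]] := irrchar_finite G charK.
pose N f := count (fun chi => gtrans (gmap iota f) chi != 0) s.
have N_gt0 f : central_idem G f -> f <> 0 -> (0 < N f)%N.
  move=> fc f0; rewrite -has_count; apply/hasPn => H; apply: f0.
  apply/ffunP => x; rewrite [RHS]ffunE; apply: (modsys_inj hOKk); rewrite rmorph0.
  have [Gx|nGx] := boolP (x \in G); last by rewrite fc.1.1 // rmorph0.
  have -> : iota (f x) = gmap iota f x by rewrite ffunE.
  apply: (rext_irr_eq0 charK _ Gx) => d rG irr.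
  have Ic : irrchar G (rchar rG) by exists d, rG.
  case: (rext_central_idem irr fc) => // r1.
  have [/negbNE/eqP g0] : _ := H _ ((sE _).2 Ic).
  case: (irrchar_block fc Ic) => -[Ib gE]; first by case/negP: (irrchar_neq0 Ic); rewrite -gE g0.
  by case: Ib; exists d, rG; split=> //; rewrite -rext_gmap.
have [m] := ubnP (N e); elim: m e => // m IH e lt_m ec.
have [->|/eqP e0] := eqVneq e 0; first by exists [::]; rewrite ?big_nil.
have [eb|neb] := pselect (is_block G e).
  by exists [:: e]; rewrite ?big_seq1 // => f; rewrite inE => /eqP->.
have [f1 [f2 [c1 c2 f12 [eE [n1 n2]]]]] : exists f1 f2, [/\ central_idem G f1, central_idem G f2, gmul f1 f2 = 0
    & e = f1 + f2 /\ f1 <> 0 /\ f2 <> 0].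
  apply: contrapT => H; apply: neb; split=> // f1 f2 c1 c2 f12 eE.
  apply: contrapT => /not_orP[n1 n2]; apply: H.
  by exists f1, f2.
have Nlt f f' : central_idem G f -> central_idem G f' -> gmul f f' = 0 -> e = f + f' -> f' <> 0 -> (N f < N e)%N.
  move=> fc fc' ff' eE' f'0.
  have f'f : gmul f' f = 0 by rewrite (fc'.1.2 _ fc.1.1).
  have disj chi : irrchar G chi -> gtrans (gmap iota f') chi != 0 -> gtrans (gmap iota f) chi = 0.
    move=> Ic; case: (irrchar_block fc' Ic) => -[_ gE]; last by rewrite gE eqxx.
    move=> _; rewrite -gE gtrans_gtrans -gmap_gmul ff'.
    by apply/ffunP => x; rewrite !ffunE big1 // => y _; rewrite !ffunE rmorph0 mul0r.
  have eD : gmap iota e = gmap iota f + gmap iota f' by rewrite eE' gmapD.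
  have le : (N f + N f' <= N e)%N.
    rewrite /N -count_predUI; set q := predI _ _.
    have -> : count q s = 0%N.
      apply/eqP; rewrite -leqn0 leqNgt -has_count; apply/hasPn => chi /sE Ic /=.
      apply/nandP; have [|nz] := boolP (gtrans (gmap iota f') chi == 0); first by right.
      by left; rewrite disj // eqxx.
    rewrite addn0 -!size_filter uniq_leq_size ?filter_uniq // => chi.
    rewrite !mem_filter => /andP[/= nz sc]; rewrite sc andbT.
    have Ic := (sE chi).1 sc; case/orP: nz => nz.
      rewrite eD gtransDl; case: (eqVneq (gtrans (gmap iota f') chi) 0) => [->|nz'].
        by rewrite addr0.
      by rewrite disj ?eqxx in nz.
    by rewrite eD gtransDl disj // add0r.
  by apply: leq_trans le; rewrite -addn1 leq_add2l N_gt0.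
have [es1 b1 f1E] : exists2 es, (forall f, f \in es -> is_block G f) & f1 = \sum_(f <- es) f.
  by apply: IH => //; exact: leq_trans (Nlt _ _ c1 c2 f12 eE n2) lt_m.
have [es2 b2 f2E] : exists2 es, (forall f, f \in es -> is_block G f) & f2 = \sum_(f <- es) f.
  apply: IH => //; apply: leq_trans (Nlt f2 f1 _ _ _ _ _) lt_m => //; last by rewrite addrC.
  by rewrite (c2.1.2 _ c1.1.1).
exists (es1 ++ es2); last by rewrite big_cat -f1E -f2E.
by move=> f; rewrite mem_cat => /orP[/b1|/b2].
Qed.

End BlockCharacters.

(** * Perfect isometries and restriction to p'-elements *)
(** The restriction of a class function to the elements of order prime to [p],
    extended by zero. *)
Definition preg (p : nat) (gT : finGroupType) (K : fieldType) (phi : kfun gT K) : kfun gT K :=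
  [ffun x => if (p^').-elt x then phi x else 0].

Section PregLinear.
Variables (p : nat) (gT : finGroupType) (K : fieldType) (G : {group gT}).
Implicit Types phi psi : kfun gT K.

Lemma preg_sum (T : Type) (s : seq T) (m : T -> K) (F : T -> kfun gT K) :
  preg p (\sum_(i <- s) m i *: F i) = \sum_(i <- s) m i *: preg p (F i).
Proof.
apply/ffunP => x; rewrite ffunE !sum_ffunE; case: ifP => px.
  by apply: eq_bigr => i _; rewrite !ffunE px.
by rewrite big1 // => i _; rewrite !ffunE px scaler0.
Qed.

Lemma preg_kclass phi : kclass G phi -> kclass G (preg p phi).
Proof.
move=> [H1 H2]; split=> [x nGx|x y Gy]; rewrite !ffunE; first by rewrite H1 // if_same.
by rewrite /p_elt orderJ H2.
Qed.

Lemma kfdot_preg phi psi : kfdot G (preg p phi) psi = kfdot G (preg p psi) phi.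
Proof.
rewrite [RHS]kfdotC /kfdot; congr (_ * _); apply: eq_bigr => x _.
by rewrite !ffunE p_eltV; case: ifP => // _; rewrite (mul0r, mulr0) ?mulr0 ?mul0r.
Qed.

End PregLinear.

Section PregBlock.
Variables (p : nat) (O : idomainType) (K k : fieldType).
Variables (iota : {rmorphism O -> K}) (res : {rmorphism O -> k}).
Hypothesis hOKk : modular_system p iota res.

(** The class functions of a block are stable under restriction to
    [p']-elements. *)
Lemma preg_block_cf (gT : finGroupType) (G : {group gT}) e (phi : kfun gT K) :
  central_idem G e -> block_cf iota G e phi -> block_cf iota G e (preg p phi).
Proof.
move=> ec [phi_cl phie]; split; first exact: preg_kclass.
apply/ffunP => g; have [pg|pg] := boolP ((p^').-elt g); last first.
  rewrite (gtrans_p_regular hOKk ec) ?ffunE ?(negPf pg) //; first exact: preg_kclass.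
  by move=> x px; rewrite ffunE px.
have psi_cl := kclassB phi_cl (preg_kclass p phi_cl).
have := gtrans_p_regular hOKk (g := g) ec psi_cl.
have -> : gtrans (gmap iota e) (phi - preg p phi) = phi - gtrans (gmap iota e) (preg p phi).
  rewrite -{3}phie; apply/ffunP => x; rewrite !ffunE -sumrB.
  by apply: eq_bigr => y _; rewrite !ffunE mulrBr.
move=> H; have /eqP : (phi - gtrans (gmap iota e) (preg p phi)) g = 0.
  by apply: H => x; rewrite pg => px; rewrite !ffunE px subrr.
by rewrite ffunE [preg p phi g]ffunE pg addr_eq0 [X in _ == - X]ffunE opprK => /eqP ->.
Qed.

Section Perfect.
Variables (gT gT' : finGroupType) (H : {group gT}) (H' : {group gT'}).
Variables (n : nat) (z : K).
Hypotheses (prim_z : (n.-primitive_root z)%R) (dvH : (#|H| %| n)%N) (dvH' : (#|H'| %| n)%N).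
Variables (e : {ffun gT -> O}) (e' : {ffun gT' -> O}).
Hypotheses (ec : central_idem H e) (ec' : central_idem H' e').
Variable J : {linear kfun gT K -> kfun gT' K}.
Hypothesis hJ : perfect_isometry p iota H H' e e' J.
Let charK := modsys_charK hOKk.

Lemma isometry_linear_sum (T : Type) (s : seq T) (m : T -> K) (F : T -> kfun gT K) :
  J (\sum_(i <- s) m i *: F i) = \sum_(i <- s) m i *: J (F i).
Proof. by rewrite linear_sum; apply: eq_bigr => i _; rewrite linearZ. Qed.

Lemma isometry_Irr chi : Irr iota H e chi -> zspan (Irr iota H' e') (J chi).
Proof. by move=> Ic; case: hJ => -[[fJ _ _] _] _; apply/fJ/Irr_zspan. Qed.

Lemma isometry_block_cf phi : block_cf iota H e phi -> block_cf iota H' e' (J phi).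
Proof.
move=> bphi; have [s us sE] := Irr_finite hOKk H e.
rewrite (block_cf_expand hOKk prim_z dvH ec us sE bphi) isometry_linear_sum.
apply: block_cf_sum => chi /sE Ic.
by apply: (zspan_block_cf hOKk prim_z dvH') => //; exact: isometry_Irr.
Qed.

Lemma isometry_surj psi : block_cf iota H' e' psi -> exists2 phi, block_cf iota H e phi & J phi = psi.
Proof.
move=> bpsi; have [s us sE] := Irr_finite hOKk H' e'.
rewrite (block_cf_expand hOKk prim_z dvH' ec' us sE bpsi).
have : {subset s <= s} by [].
elim: {1 3}s => [|chi t IH] sub.
  exists 0; last by rewrite big_nil linear0.
  rewrite -[0](big_nil _ +%R xpredT (fun i : nat => (0 : K) *: (0 : kfun gT K))).
  exact: block_cf_sum.
have [phi bphi phiE] : exists2 phi, block_cf iota H e phi & J phi = \sum_(i <- t) (kfdot H' psi i / kfdot H' i i) *: i.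
  by apply: IH => x tx; apply: sub; rewrite inE tx orbT.
have /sE/Irr_zspan Ic : chi \in s by apply: sub; rewrite mem_head.
have [y zy yE] : exists2 y, zspan (Irr iota H e) y & J y = chi.
  by case: hJ => -[[_ _ sJ] _] _; have [y ? ?] := sJ _ Ic; exists y.
have by_ := zspan_block_cf hOKk prim_z dvH ec zy.
exists (\sum_(q <- [:: (kfdot H' psi chi / kfdot H' chi chi, y); (1, phi)]) q.1 *: q.2).
  apply: block_cf_sum => q.
  by rewrite !inE => /orP[/eqP->|/eqP->].
by rewrite isometry_linear_sum !big_cons big_nil /= phiE yE scale1r addr0.
Qed.

(** The isometry property extends from the lattices to their [K]-spans. *)
Lemma isometry_kfdot phi psi : block_cf iota H e phi -> block_cf iota H e psi ->
  kfdot H' (J phi) (J psi) = kfdot H phi psi.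
Proof.
move=> bphi bpsi; have [s us sE] := Irr_finite hOKk H e.
rewrite {1}(block_cf_expand hOKk prim_z dvH ec us sE bphi).
rewrite [in RHS](block_cf_expand hOKk prim_z dvH ec us sE bphi).
rewrite isometry_linear_sum !kfdot_suml; apply: eq_big_seq => chi /sE Ic; congr (_ * _).
rewrite [LHS]kfdotC [RHS]kfdotC.
rewrite {1}(block_cf_expand hOKk prim_z dvH ec us sE bpsi).
rewrite [in RHS](block_cf_expand hOKk prim_z dvH ec us sE bpsi).
rewrite isometry_linear_sum !kfdot_suml; apply: eq_big_seq => eta /sE Ie; congr (_ * _).
by case: hJ => -[_ iJ] _; apply: iJ; apply: Irr_zspan.
Qed.

Lemma block_cf_nondeg (gT0 : finGroupType) (H0 : {group gT0}) e0 (phi : kfun gT0 K) :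
    (#|H0| %| n)%N -> central_idem H0 e0 -> block_cf iota H0 e0 phi ->
    (forall psi, block_cf iota H0 e0 psi -> kfdot H0 phi psi = 0) ->
  phi = 0.
Proof.
move=> dv0 e0c bphi orth; have [s us sE] := Irr_finite hOKk H0 e0.
rewrite (block_cf_expand hOKk prim_z dv0 e0c us sE bphi) big_seq big1 // => chi /sE Ic.
rewrite orth ?mul0r ?scale0r //; exact: (Irr_block_cf hOKk prim_z dv0).
Qed.

Lemma isometry_inj phi : block_cf iota H e phi -> J phi = 0 -> phi = 0.
Proof.
move=> bphi J0; apply: (block_cf_nondeg dvH ec bphi) => psi bpsi.
rewrite -isometry_kfdot // J0 /kfdot big1 ?mulr0 // => x _.
by rewrite ffunE; exact: mul0r.
Qed.

Lemma muE s g' g : uniq s -> (forall chi, chi \in s <-> Irr iota H e chi) ->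
  mu iota H e J g' g = \sum_(chi <- s) (J chi g' : K) * chi (g^-1)%g.
Proof.
move=> us sE.
have IE : Irr iota H e = [set` s]%classic.
  by apply/seteqP; split=> chi /sE.
by rewrite /mu IE -fsbig_seq.
Qed.

(** As [K] is not assumed to split the groups, the norms [l chi] of the
    irreducible characters are only known to be positive integers; the kernel
    [mu] represents [chi |-> l chi *: J chi]. Let [D] and [D'] be the symmetric
    Gram matrices of the restrictions to [p']-elements of the [chi] and of the
    [J chi]. Perfectness reads [l psi * D = l chi * D'] at the entry [(chi, psi)],
    and by symmetry [l chi * D = l psi * D']; since the norms are positive integers, [D = D']. *)
Lemma isometry_kfdot_preg chi psi : Irr iota H e chi -> Irr iota H e psi ->
  kfdot H (preg p chi) psi = kfdot H' (preg p (J chi)) (J psi).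
Proof.
move=> Ic Ip; have [s us sE] := Irr_finite hOKk H e.
have bI eta : Irr iota H e eta -> block_cf iota H e eta := Irr_block_cf hOKk prim_z dvH ec.
(* [T] is the operator with kernel [mu]. *)
pose T (phi : kfun gT K) : kfun gT' K := \sum_(eta <- s) kfdot H phi eta *: J eta.
have TE phi g' : T phi g' = #|H|%:R^-1 * \sum_(x in H) mu iota H e J g' x * (phi x : K).
  rewrite sum_ffunE.
  transitivity (\sum_(eta <- s) #|H|%:R^-1 * \sum_(x in H) (J eta g' : K) * eta (x^-1)%g * phi x).
    apply: eq_bigr => eta _; rewrite ffunE /kfdot /GRing.scale /= -mulrA mulr_suml.
    congr (_ * _); apply: eq_bigr => x _; rewrite [LHS]mulrC -mulrA; congr (_ * _); exact: mulrC.
  rewrite -mulr_sumr exchange_big /=; congr (_ * _); apply: eq_bigr => x _.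
  by rewrite (muE _ _ us sE) mulr_suml.
have T_preg phi : T (preg p phi) = preg p (T phi).
  apply/ffunP => g'; rewrite [RHS]ffunE.
  have [Hg'|nHg'] := boolP (g' \in H'); last first.
    have T0 phi1 : T phi1 g' = 0.
      rewrite sum_ffunE big_seq big1 // => eta /sE Ie; rewrite ffunE.
      have [[J0 _] _] := isometry_block_cf (bI _ Ie).
      by rewrite J0 // scaler0.
    by rewrite !T0 if_same.
  rewrite !TE; case: ifP => pg'.
    congr (_ * _); apply: eq_bigr => x Hx; rewrite ffunE; case: ifP => // px.
    have [_ _ ->] := hJ.2 x g' Hx Hg'; first by rewrite !mul0r.
    by rewrite px pg'.
  rewrite big1 ?mulr0 // => x Hx; rewrite ffunE; case: ifP => px; last exact: mulr0.
  have [_ _ ->] := hJ.2 x g' Hx Hg'; first by rewrite mul0r.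
  by rewrite px pg'.
have key eta xi : Irr iota H e eta -> Irr iota H e xi ->
    kfdot H xi xi * kfdot H (preg p eta) xi = kfdot H eta eta * kfdot H' (preg p (J eta)) (J xi).
  move=> Ie Ix; have Teta : T eta = kfdot H eta eta *: J eta.
    rewrite /T (bigD1_seq eta) //=; last exact/sE.
    rewrite big_seq_cond big1 ?addr0 // => t /andP[/sE It net].
    rewrite (irrchar_orth (Irr_irrchar Ie) (Irr_irrchar It)) ?scale0r //.
    by apply/eqP; rewrite eq_sym.
  have -> : kfdot H eta eta * kfdot H' (preg p (J eta)) (J xi) = kfdot H' (preg p (T eta)) (J xi).
    rewrite Teta -kfdotZl; congr kfdot; apply/ffunP => x; rewrite !ffunE.
    by case: ifP; rewrite ?scaler0.
  rewrite -T_preg /T kfdot_suml (bigD1_seq xi) //=; last exact/sE.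
  rewrite big_seq_cond big1 ?addr0 => [|t /andP[/sE It nxt]].
    by rewrite (isometry_kfdot (bI _ Ix) (bI _ Ix)); exact: mulrC.
  rewrite (isometry_kfdot (bI _ It) (bI _ Ix)).
  rewrite (irrchar_orth (Irr_irrchar It) (Irr_irrchar Ix)) ?mulr0 //.
  exact/eqP.
have e1 := key _ _ Ic Ip; have e2 := key _ _ Ip Ic.
rewrite kfdot_preg [in RHS]kfdot_preg in e2.
have [r r0 nr] := irrchar_norm charK (Irr_irrchar Ic).
have [q q0 nq] := irrchar_norm charK (Irr_irrchar Ip).
rewrite nr nq in e1 e2; set D := kfdot H _ _ in e1 e2 *; set D' := kfdot H' _ _ in e1 e2 *.
have rK : r%:R != 0 :> K by rewrite pchar0_natr_eq0 // -lt0n.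
have qK : q%:R != 0 :> K by rewrite pchar0_natr_eq0 // -lt0n.
(* If the norms [r] and [q] differ, then [q ^ 2 * D = r ^ 2 * D] gives [D = 0],
   and [D' = 0] follows. *)
have [rq|nrq] := eqVneq r q; first by apply: (mulfI qK); rewrite e1 rq.
have D0 : D = 0.
  have : (q ^ 2)%:R * D = (r ^ 2)%:R * D.
    by rewrite -!mulnn !natrM -!mulrA e1 e2 mulrCA.
  move/eqP; rewrite -subr_eq0 -mulrBl mulf_eq0 => /orP[|/eqP//].
  rewrite subr_eq0; case: (ltngtP (q ^ 2) (r ^ 2)) => lt.
  - by rewrite -(subnK (ltnW lt)) natrD -subr_eq0 opprD addrCA subrr addr0 oppr_eq0 pchar0_natr_eq0 // subn_eq0 leqNgt lt.
  - by rewrite -(subnK (ltnW lt)) natrD -subr_eq0 addrK pchar0_natr_eq0 // subn_eq0 leqNgt lt.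
  by move/eqP: lt; rewrite eqn_exp2r // eq_sym (negPf nrq).
move/eqP: e1; rewrite D0 mulr0 eq_sym mulf_eq0 (negPf rK) /= => /eqP->; done.
Qed.

(** A perfect isometry commutes with the restriction to [p']-elements. *)
Lemma isometry_preg phi : block_cf iota H e phi -> J (preg p phi) = preg p (J phi).
Proof.
move=> bphi; have [s us sE] := Irr_finite hOKk H e.
have bI eta : Irr iota H e eta -> block_cf iota H e eta := Irr_block_cf hOKk prim_z dvH ec.
apply/eqP; rewrite -subr_eq0; apply/eqP.
have b1 : block_cf iota H' e' (J (preg p phi)) by apply/isometry_block_cf/preg_block_cf.
have b2 : block_cf iota H' e' (preg p (J phi)) by apply/preg_block_cf/isometry_block_cf.
have dE : J (preg p phi) - preg p (J phi) =
    \sum_(q <- [:: (1, J (preg p phi)); (-1, preg p (J phi))]) q.1 *: q.2.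
  by rewrite !big_cons big_nil /= addr0 scale1r scaleN1r.
apply: (block_cf_nondeg dvH' ec').
  by rewrite dE; apply: block_cf_sum => q; rewrite !inE => /orP[/eqP->|/eqP->].
move=> psi' /isometry_surj[psi bpsi <-].
rewrite dE kfdot_suml !big_cons big_nil /= addr0 mul1r mulN1r.
apply/eqP; rewrite subr_eq0; apply/eqP.
rewrite isometry_kfdot //; last exact: preg_block_cf.
have expand := block_cf_expand hOKk prim_z dvH ec us sE.
rewrite (expand _ bphi) isometry_linear_sum !preg_sum !kfdot_suml.
apply: eq_big_seq => chi /sE Ic; congr (_ * _).
rewrite [LHS]kfdotC [RHS]kfdotC (expand _ bpsi) isometry_linear_sum !kfdot_suml.
apply: eq_big_seq => eta /sE Ie; congr (_ * _).
by rewrite [LHS]kfdotC [RHS]kfdotC; exact: isometry_kfdot_preg.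
Qed.

End Perfect.
End PregBlock.

(** * Fields of values *)
Section ValuedIn.
Variables (E K : fieldType) (eps : {rmorphism E -> K}).

(** [E], embedded in [K] by [eps], contains all values of [phi]. *)
Definition valued (gT : finGroupType) (phi : kfun gT K) : Prop :=
  forall x, exists y, phi x = eps y.

Lemma image_sum (T : eqType) (s : seq T) (F : T -> K) :
  (forall i, i \in s -> exists y, F i = eps y) -> exists y, \sum_(i <- s) F i = eps y.
Proof.
elim: s => [|i s IH] H; first by exists 0; rewrite big_nil rmorph0.
have [y yE] := H i (mem_head _ _).
have [t tE] := IH (fun j sj => H j (mem_behead (s := i :: s) sj)).
by exists (y + t); rewrite big_cons yE tE rmorphD.
Qed.

Lemma image_mul x y : (exists a, x = eps a) -> (exists a, y = eps a) -> exists a, x * y = eps a.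
Proof. by move=> [a ->] [c ->]; exists (a * c); rewrite rmorphM. Qed.

Lemma valued_sum (gT : finGroupType) (T : eqType) (s : seq T) (m : T -> K) (F : T -> kfun gT K) :
  (forall i, i \in s -> exists y, m i = eps y) -> (forall i, i \in s -> valued (F i)) ->
  valued (\sum_(i <- s) m i *: F i).
Proof.
move=> mE FE x; rewrite sum_ffunE; apply: image_sum => i si; rewrite ffunE.
by apply: image_mul; [exact: mE | exact: FE].
Qed.

(** A linear system over [E] that is solvable over [K] is solvable over [E]. *)
Lemma valued_descent (gT : finGroupType) m (F : 'I_m -> kfun gT K) (a : 'I_m -> K) phi :
    (forall i, valued (F i)) -> valued phi -> phi = \sum_i a i *: F i ->
  exists c : 'I_m -> E, phi = \sum_i eps (c i) *: F i.
Proof.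
move=> FE phiE phi_sum; have [f fE] := choice phiE.
have [A AE] := choice (fun q : 'I_m * gT => FE q.1 q.2).
pose M : 'M[E]_(m, #|gT|) := \matrix_(i, j) A (i, enum_val j).
pose v : 'rV[E]_#|gT| := \row_j f (enum_val j).
have : (map_mx eps v <= map_mx eps M)%MS.
  apply/submxP; exists (\row_i a i); apply/rowP => j; rewrite !mxE -fE phi_sum sum_ffunE.
  by apply: eq_bigr => i _; rewrite !mxE ffunE -(AE (i, enum_val j)).
rewrite map_submx => /submxP[D vD]; exists (fun i => D 0 i).
apply/ffunP => x; rewrite sum_ffunE fE.
have -> : f x = v 0 (enum_rank x) by rewrite mxE enum_rankK.
rewrite vD mxE rmorph_sum; apply: eq_bigr => i _.
by rewrite !mxE rmorphM ffunE (AE (i, x)) enum_rankK.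
Qed.

End ValuedIn.

Section ValuedBlocks.
Variables (p : nat) (O : idomainType) (K k : fieldType).
Variables (iota : {rmorphism O -> K}) (res : {rmorphism O -> k}).
Hypothesis hOKk : modular_system p iota res.
Variables (n : nat) (z : K).
Hypothesis prim_z : (n.-primitive_root z)%R.
Variables (E : fieldType) (eps : {rmorphism E -> K}).
Hypothesis hE : forall w : K, w ^+ partn n p^' = 1 -> exists y, w = eps y.
Let charK := modsys_charK hOKk.

Section Local.
Variables (gT : finGroupType) (H : {group gT}).
Hypothesis dvH : (#|H| %| n)%N.

(** Values at [p']-elements are sums of [p']-roots of unity. *)
Lemma irrchar_p_regular_image chi x : irrchar H chi -> (p^').-elt x -> exists y, chi x = eps y.
Proof.
move=> [d [rG [irr ->]]] px; have [Hx|nHx] := boolP (x \in H); last first.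
  by exists 0; rewrite (rchar_kclass rG).1 // rmorph0.
have ox : (#[x]%g %| n)%N by apply: dvdn_trans dvH; exact: order_dvdG.
have [D trD D1] := mxtrace_repr_roots rG prim_z Hx ox.
rewrite rcharE // trD -big_enum; apply: image_sum => i _; apply: hE.
have n_gt0 := prim_order_gt0 prim_z.
have : (#[x]%g %| partn n p^')%N by rewrite -(part_pnat_id px) partn_dvd.
by case/dvdnP=> q ->; rewrite mulnC exprM D1 expr1n.
Qed.

Lemma valued_preg_irrchar chi : irrchar H chi -> valued eps (preg p chi).
Proof.
move=> Ic x; rewrite ffunE; case: ifP => px; first exact: irrchar_p_regular_image.
by exists 0; rewrite rmorph0.
Qed.

Lemma valued_preg_zspan e phi : zspan (Irr iota H e) phi -> valued eps (preg p phi).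
Proof.
move=> [m [c [x [Ix ->]]]].
rewrite (eq_bigr (fun i => (c i)%:~R *: x i)) => [|i _]; last by rewrite scaler_int.
rewrite preg_sum -big_enum; apply: valued_sum => i _.
  by exists (c i)%:~R; rewrite rmorph_int.
by apply/valued_preg_irrchar/Irr_irrchar/Ix.
Qed.

(** The coefficients of a central idempotent lie in [E]: at [p']-elements they
    are combinations of values of irreducible characters, with rational
    coefficients. *)
Lemma central_idem_image e x : central_idem H e -> exists y, iota (e x) = eps y.
Proof.
move=> ec; have [px|px] := boolP ((p^').-elt x); last first.
  by exists 0; rewrite (central_idem_p_regular hOKk ec) // !rmorph0.
pose phi : kfun gT K := [ffun y => iota (e y^-1%g)].
have phi_cl : kclass H phi.
  split=> [y nHy|y t Ht]; rewrite !ffunE; first by rewrite ec.1.1 ?rmorph0 ?groupV.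
  by rewrite -conjVg (gcenterJ _ ec.1).
have -> : iota (e x) = phi x^-1%g by rewrite ffunE invgK.
have [s [us sE]] := irrchar_finite H charK.
rewrite (kclass_expand hOKk prim_z dvH us sE phi_cl) sum_ffunE.
apply: image_sum => chi /sE Ic; rewrite ffunE.
apply: image_mul; last by apply: irrchar_p_regular_image; rewrite ?p_eltV.
have [r r0 nr] := irrchar_norm charK Ic.
have [q qE] : exists q : nat, gtrans (gmap iota e) chi 1%g = q%:R.
  case: (irrchar_block hOKk prim_z dvH ec Ic) => -[_ ->]; last by exists 0%N; rewrite ffunE.
  case: Ic => d [rG [_ ->]]; exists d.
  by rewrite rcharE // repr_mx1 mxtrace1.
exists (#|H|%:R^-1 * q%:R / r%:R); rewrite nr !rmorphM !fmorphV !rmorph_nat -qE; congr (_ * _ / _).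
rewrite [RHS]ffunE [RHS](reindex_inj invg_inj) [RHS](bigID (mem H)) /=.
rewrite [X in _ = _ + X]big1 ?addr0.
  by apply: eq_big => [y|y Hy]; rewrite ?groupV // !ffunE mul1g.
by move=> y nHy; rewrite ffunE ec.1.1 ?groupV // rmorph0 mul0r.
Qed.

End Local.

(** A class function [psi] of the block supported on [p']-elements has values in
    [E] if and only if its image under a perfect isometry does: both have the
    same coordinates on spanning families with values in [E]. *)
Lemma perfect_isometry_valued (gT gT' : finGroupType) (H : {group gT}) (H' : {group gT'}) e e'
    (J : {linear kfun gT K -> kfun gT' K}) psi :
    (#|H| %| n)%N -> (#|H'| %| n)%N -> central_idem H e -> central_idem H' e' ->
    perfect_isometry p iota H H' e e' J -> block_cf iota H e psi -> preg p psi = psi ->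
  valued eps psi <-> valued eps (J psi).
Proof.
move=> dvH dvH' ec ec' hJ bpsi psi_reg; have [s us sE] := Irr_finite hOKk H e.
have sI (i : 'I_(size s)) : Irr iota H e s`_i by apply/sE; exact: mem_nth.
have bI (i : 'I_(size s)) : block_cf iota H e s`_i := Irr_block_cf hOKk prim_z dvH ec (sI i).
have F1 (i : 'I_(size s)) : valued eps (preg p s`_i).
  by apply: (valued_preg_irrchar dvH); exact: Irr_irrchar (sI i).
have F2 (i : 'I_(size s)) : valued eps (preg p (J s`_i)).
  by apply: (valued_preg_zspan dvH' (e := e')); apply: (isometry_Irr hJ).
have [a psiE] : exists a : 'I_(size s) -> K, psi = \sum_i a i *: preg p s`_i.
  exists (fun i => kfdot H psi s`_i / kfdot H s`_i s`_i).
  rewrite -{1}psi_reg {1}(block_cf_expand hOKk prim_z dvH ec us sE bpsi).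
  by rewrite (big_nth 0) big_mkord preg_sum.
have JE (c : 'I_(size s) -> K) : J (\sum_i c i *: preg p s`_i) = \sum_i c i *: preg p (J s`_i).
  rewrite isometry_linear_sum; apply: eq_bigr => i _.
  by rewrite (isometry_preg hOKk prim_z dvH dvH' ec ec' hJ).
split=> [vpsi|vJ].
  have [c cE] := valued_descent F1 vpsi psiE.
  rewrite cE JE -big_enum; apply: valued_sum => i _ //.
  by exists (c i).
have JpsiE : J psi = \sum_i a i *: preg p (J s`_i) by rewrite {1}psiE JE.
have [c cE] := valued_descent F2 vJ JpsiE.
suff -> : psi = \sum_i eps (c i) *: preg p s`_i.
  by rewrite -big_enum; apply: valued_sum => i _ //; exists (c i).
apply/eqP; rewrite -subr_eq0; apply/eqP.
apply: (isometry_inj hOKk prim_z dvH ec hJ); last by rewrite linearB /= JE cE subrr.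
have -> : psi - \sum_i eps (c i) *: preg p s`_i = \sum_i (a i - eps (c i)) *: preg p s`_i.
  by rewrite {1}psiE -sumrB; apply: eq_bigr => i _; rewrite scalerBl.
by apply: block_cf_sum => i _; apply: (preg_block_cf hOKk).
Qed.

Section Global.
Variables (gT : finGroupType) (G : {group gT}) (b : {ffun gT -> O}).
Hypotheses (dvG : (#|G| %| n)%N) (bc : central_idem G b).

Lemma dvdn_cent1 u : (#|'C_G[u]%g| %| n)%N.
Proof. by apply: dvdn_trans dvG; rewrite cardSg ?subsetIl. Qed.

(** [dec_map (u, e) phi] is the restriction to [p']-elements of the class
    function [s |-> phi (u s e)] of the block [e]. *)
Lemma dec_map_block_cf u e phi : u \in G -> central_idem 'C_G[u] e -> kclass G phi ->
  exists2 psi, block_cf iota 'C_G[u] e psi & dec_map p iota G (u, e) phi = preg p psi.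
Proof.
move=> Gu ec phi_cl; set C := 'C_G[u]%G.
have CG x : x \in 'C_G[u]%g -> x \in G by rewrite inE => /andP[].
pose psi : kfun gT K := [ffun s => if s \in 'C_G[u]%g then gtrans (gmap iota e) phi (u * s)%g else 0].
exists psi; last first.
  by apply/ffunP => s; rewrite dec_mapE /= !ffunE; case: (s \in _); case: (p_elt _ _).
split.
  split=> [x nCx|x y Cy]; rewrite !ffunE; first by rewrite (negPf nCx).
  rewrite groupJr //; case: ifP => // Cx.
  rewrite [LHS](reindex_inj (conjg_inj y)) /=; apply: eq_bigr => t _.
  rewrite !ffunE (gcenterJ _ ec.1 Cy).
  have uy : (u ^ y)%g = u.
    by apply/conjg_fixP/commgP; move: Cy; rewrite inE cent1C => /andP[_ /cent1P].
  by rewrite -{1}uy -!conjMg phi_cl.2 // CG.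
apply/ffunP => s; rewrite [RHS]ffunE; case: ifP => Cs; last first.
  rewrite ffunE big1 // => x _; have [Cx|nCx] := boolP (x \in 'C_G[u]%g).
    by rewrite [psi _]ffunE groupMr // Cs mulr0.
  by rewrite [gmap _ _ _]ffunE ec.1.1 // rmorph0 mul0r.
rewrite -[in RHS]ec.2 gmap_gmul -gtrans_gtrans !ffunE; apply: eq_bigr => x _.
have [Cx|nCx] := boolP (x \in 'C_G[u]%g).
  by rewrite [psi _]ffunE groupM // mulgA.
by rewrite [gmap _ _ _]ffunE ec.1.1 // rmorph0 !mul0r.
Qed.

Lemma valued_dec_map u e phi : u \in G -> central_idem 'C_G[u] e ->
  valued eps phi -> valued eps (dec_map p iota G (u, e) phi).
Proof.
move=> Gu ec vphi s; rewrite dec_mapE; case: ifP => _; last by exists 0; rewrite rmorph0.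
rewrite ffunE /= -big_enum; apply: image_sum => x _; rewrite ffunE; apply: image_mul => //.
by apply: (central_idem_image (dvdn_cent1 u)).
Qed.

Lemma dec_map_conj u e g phi s : g \in G -> kclass G phi ->
  dec_map p iota G (belt_conj (u, e) g) phi (s ^ g)%g = dec_map p iota G (u, e) phi s.
Proof.
move=> Gg phi_cl; rewrite !dec_mapE /=.
have -> : ((s ^ g)%g \in 'C_G[u ^ g]%g) = (s \in 'C_G[u]%g).
  by rewrite !finset.in_setI groupJr // !cent1E -!conjMg (inj_eq (conjg_inj g)).
rewrite /p_elt orderJ; case: ifP => // _.
rewrite !ffunE (reindex_inj (conjg_inj g)) /=; apply: eq_bigr => x _.
by rewrite !ffunE conjgK -!conjMg phi_cl.2.
Qed.

Lemma central_idem1 (H : {group gT}) : central_idem H (gbasis O 1%g).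
Proof.
split; last by apply/ffunP => x; rewrite gmul_gbasisl invg1 mul1g.
split; first exact: gbasis_galg.
by move=> c _; apply/ffunP => x; rewrite gmul_gbasisl gmul_gbasisr invg1 mul1g mulg1.
Qed.

(** The values of [phi] are recovered from representatives of the Brauer
    elements. *)
Lemma valued_of_dec_map R phi : belt_reps p res G b R -> block_cf iota G b phi ->
  (forall ue, R ue -> valued eps (dec_map p iota G ue phi)) -> valued eps phi.
Proof.
move=> [_ Rrep] [phi_cl phib] vdec x.
have [Gx|/phi_cl.1->] := boolP (x \in G); last by exists 0; rewrite rmorph0.
pose u := x.`_p; pose s := x.`_p^'.
have Gu : u \in G by rewrite groupX.
have Cs : s \in 'C_G[u]%g.
  by rewrite inE groupX //=; apply/cent1P; exact: commuteX2.
have [es ebl e1] := central_idem_sum_blocks hOKk prim_z (dvdn_cent1 u) (central_idem1 'C_G[u]).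
have decE e : dec_map p iota G (u, e) phi s = gtrans (gmap iota e) phi x.
  by rewrite dec_mapE /= Cs p_elt_constt consttC.
have -> : phi x = \sum_(e <- es) dec_map p iota G (u, e) phi s.
  transitivity (gtrans (gmap iota (gbasis O 1%g)) phi x).
    rewrite ffunE (bigD1 1%g) //= !ffunE eqxx rmorph1 mul1r mulg1 big1 ?addr0 // => y ny1.
    by rewrite !ffunE (negPf ny1) rmorph0 mul0r.
  rewrite e1; under [RHS]eq_bigr do rewrite decE.
  elim: (es) => [|e t IH]; last by rewrite !big_cons gmapD gtransDl ffunE IH.
  by rewrite !big_nil ffunE big1 // => y _; rewrite !ffunE rmorph0 mul0r.
apply: image_sum => e /ebl eb; have [ec _ _] := eb.
have [br|nbr] := pselect (brauer_element p res G b (u, e)).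
  have [r [[Rr [g Gg rE]] _]] := Rrep _ br.
  by rewrite -(dec_map_conj u e s Gg phi_cl) -rE; exact: vdec.
exists 0; rewrite rmorph0.
have pu : p.-elt u := p_elt_constt _ _.
rewrite (dec_map_not_brauer hOKk bc ec Gu pu) ?ffunE //.
by apply: contrapT => Br; apply: nbr; split.
Qed.

End Global.

(** An isotypy preserves and reflects the property of having values in [E]. *)
Lemma isotypy_valued (gT gT' : finGroupType) (G : {group gT}) (G' : {group gT'}) b b'
    (I : {linear kfun gT K -> kfun gT' K}) R R' f Iloc phi :
    (#|G| %| n)%N -> (#|G'| %| n)%N -> central_idem G b -> central_idem G' b' ->
    is_isotypy p iota res G G' b b' I R R' f Iloc -> block_cf iota G b phi ->
  valued eps phi <-> valued eps (I phi).
Proof.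
move=> dvG dvG' bc bc' iso bphi.
have hI := isotypy_perfect iso.
have bphi' := isometry_block_cf hOKk prim_z dvG dvG' bc bc' hI bphi.
have repsR := isotypy_reps iso; have repsR' := isotypy_reps' iso.
have [fR _ fsurj] := isotypy_bij iso.
have kphi := block_cf_kspan hOKk prim_z dvG bc bphi.
have dec ue : R ue -> valued eps (dec_map p iota G ue phi) <->
    valued eps (dec_map p iota G' (f ue) (I phi)).
  move=> Rue; rewrite (isotypy_dec iso Rue kphi).
  have [Gu pu [ec _ _] _] := repsR.1 _ Rue.
  have [Gu' pu' [ec' _ _] _] := repsR'.1 _ (fR _ Rue).
  have [psi bpsi psiE] := dec_map_block_cf Gu ec bphi.1.
  rewrite -surjective_pairing in psiE.
  apply: (perfect_isometry_valued (dvdn_cent1 dvG _) (dvdn_cent1 dvG' _) ec ec' (isotypy_local iso Rue)).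
    by rewrite psiE; exact: (preg_block_cf hOKk).
  by rewrite psiE; apply/ffunP => x; rewrite !ffunE; case: (p_elt _ x).
split=> v.
  apply: (valued_of_dec_map dvG' bc' repsR' bphi') => ue' /fsurj[ue Rue <-].
  have [Gu pu [ec _ _] _] := repsR.1 _ Rue.
  by apply/dec => //; rewrite [ue]surjective_pairing; apply: valued_dec_map.
apply: (valued_of_dec_map dvG bc repsR bphi) => ue Rue.
have [Gu' pu' [ec' _ _] _] := repsR'.1 _ (fR _ Rue).
by apply/dec => //; rewrite [f ue]surjective_pairing; apply: valued_dec_map.
Qed.

End ValuedBlocks.

(** * Subfields generated by one element *)
Section RationalAdjunction.
Variables (L : fieldType) (charL : [pchar L] =i pred0).

Lemma pchar0_intr_eq0 (i : int) : (i%:~R == 0 :> L) = (i == 0).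
Proof.
case: i => m; last rewrite NegzE mulrNz oppr_eq0 oppr_eq0.
  by rewrite -[Posz m]/(m%:Z) -pmulrn; move/pcharf0P: charL => ->.
by rewrite -pmulrn; move/pcharf0P: charL => ->.
Qed.

(** [ratr] is computed by any representation as a fraction, in characteristic
    [0]. *)
Lemma ratr_frac (a b : int) : b != 0 -> ratr (a%:~R / b%:~R : rat) = a%:~R / b%:~R :> L.
Proof.
move=> b0; rewrite /ratr; set x : rat := _ / _.
have xb : (numq x * b)%:~R = (a * denq x)%:~R :> rat.
  by rewrite !intrM numqE mulrAC divfK // intr_eq0.
apply/eqP; rewrite eqr_div ?pchar0_intr_eq0 ?denq_eq0 // -!intrM.
by rewrite (intr_inj xb).
Qed.

(** The embedding of the rational numbers in a field of characteristic [0]. *)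
Definition rat_emb of [pchar L] =i pred0 : rat -> L := ratr.

Lemma rat_fracP (x : rat) : exists a b : int, b != 0 /\ x = a%:~R / b%:~R.
Proof. by exists (numq x), (denq x); rewrite denq_eq0 divq_num_den. Qed.

Fact rat_emb_is_zmod_morphism : zmod_morphism (rat_emb charL).
Proof.
move=> x y; have [a [b [b0 ->]]] := rat_fracP x; have [c [d [d0 ->]]] := rat_fracP y.
have -> : a%:~R / b%:~R - c%:~R / d%:~R = (a * d - c * b)%:~R / (b * d)%:~R :> rat.
  by rewrite rmorphB !rmorphM /=; field; rewrite !intr_eq0 b0 d0.
rewrite /rat_emb !ratr_frac ?mulf_neq0 // rmorphB !rmorphM /=.
by field; rewrite !pchar0_intr_eq0 b0 d0.
Qed.

Fact rat_emb_is_monoid_morphism : monoid_morphism (rat_emb charL).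
Proof.
split=> [|x y]; first by rewrite /rat_emb (ratr_int _ 1).
have [a [b [b0 ->]]] := rat_fracP x; have [c [d [d0 ->]]] := rat_fracP y.
have -> : a%:~R / b%:~R * (c%:~R / d%:~R) = (a * c)%:~R / (b * d)%:~R :> rat.
  by rewrite !rmorphM /=; field; rewrite !intr_eq0 b0 d0.
rewrite /rat_emb !ratr_frac ?mulf_neq0 // !rmorphM /=.
by field; rewrite !pchar0_intr_eq0 b0 d0.
Qed.

HB.instance Definition _ :=
  GRing.isZmodMorphism.Build rat L (rat_emb charL) rat_emb_is_zmod_morphism.
HB.instance Definition _ :=
  GRing.isMonoidMorphism.Build rat L (rat_emb charL) rat_emb_is_monoid_morphism.

Local Notation "p ^q" := (map_poly (rat_emb charL) p) (at level 2, format "p ^q").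

Lemma in_QadjoinE (z x : L) : in_Qadjoin z x <->
  exists r s : {poly rat}, (s^q).[z] != 0 /\ x = (r^q).[z] / (s^q).[z].
Proof. by []. Qed.

(** Membership in the subfield generated by [z]; the characteristic is a
    parameter because closure under the field operations depends on it. *)
Definition Qadjoin_pred of [pchar L] =i pred0 := fun z : L =>
  [pred x : L | `[< in_Qadjoin z x >]].
Local Notation Qadjoin := (Qadjoin_pred charL).

Lemma QadjoinP z x : reflect (in_Qadjoin z x) (x \in Qadjoin z).
Proof. exact: asboolP. Qed.

Fact Qadjoin_divring_closed z : divring_closed (Qadjoin z).
Proof.
split=> [|x y|x y].
- apply/QadjoinP/in_QadjoinE; exists 1, 1.
  by rewrite rmorph1 hornerC oner_neq0 divr1.
- move=> /QadjoinP[r [s [s0 ->]]] /QadjoinP[r' [s' [s0' ->]]].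
  rewrite -/(rat_emb charL) in s0 s0' *.
  apply/QadjoinP/in_QadjoinE; exists (r * s' - r' * s), (s * s').
  rewrite rmorphB !rmorphM /= !hornerE; split; first by rewrite mulf_neq0.
  by field; rewrite s0 s0'.
move=> /QadjoinP[r [s [s0 ->]]] /QadjoinP[r' [s' [s0' ->]]].
rewrite -/(rat_emb charL) in s0 s0' *; apply/QadjoinP/in_QadjoinE.
have [e|nz] := eqVneq ((r'^q).[z]) 0.
  exists 0, 1; rewrite rmorph1 rmorph0 !hornerC oner_neq0 e; split=> //.
  by rewrite mul0r invr0 mulr0 mul0r.
exists (r * s'), (s * r'); rewrite !rmorphM /= !hornerM; split; first by rewrite mulf_neq0.
by field; rewrite s0 s0' nz.
Qed.

HB.instance Definition _ z := GRing.isDivringClosed.Build L (Qadjoin z) (Qadjoin_divring_closed z).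

End RationalAdjunction.

Section QadjoinField.
Variables (L : fieldType) (charL : [pchar L] =i pred0) (z : L).

(** The field [Q(z)] as a type. *)
Record Qadjoin := QadjoinElt { Qadjoin_val : L; _ : Qadjoin_val \in Qadjoin_pred charL z }.

HB.instance Definition _ := [isSub for Qadjoin_val].
HB.instance Definition _ := [Choice of Qadjoin by <:].
HB.instance Definition _ := [SubChoice_isSubIntegralDomain of Qadjoin by <:].
HB.instance Definition _ := [SubIntegralDomain_isSubField of Qadjoin by <:].

Definition Qadjoin_emb : {rmorphism Qadjoin -> L} := val.

Lemma Qadjoin_embP x : in_Qadjoin z x <-> exists y, x = Qadjoin_emb y.
Proof.
split=> [/(QadjoinP charL) zx|[y ->]]; last by apply/(QadjoinP charL); case: y.
by exists (QadjoinElt zx).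
Qed.

End QadjoinField.

(** * Galois conjugation of roots of unity *)
Arguments rat_emb : simpl never.

Section QadjoinTheory.
Variables (L : fieldType) (charL : [pchar L] =i pred0).
Implicit Types x y z w : L.
Local Notation "p ^q" := (map_poly (rat_emb charL) p) (at level 2, format "p ^q").

Lemma in_Qadjoin_gen z : in_Qadjoin z z.
Proof.
apply/(in_QadjoinE charL); exists 'X, 1.
by rewrite rmorph1 map_polyX hornerX hornerC oner_neq0 divr1.
Qed.

Lemma in_Qadjoin_trans y z x : in_Qadjoin y z -> in_Qadjoin z x -> in_Qadjoin y x.
Proof.
move=> /(QadjoinP charL) yz [r [s [_ ->]]]; apply/(QadjoinP charL).
have H (q : {poly rat}) : (map_poly ratr q).[z] \in Qadjoin_pred charL y.
  apply: rpred_horner => //; apply/polyOverP => i; rewrite coef_map_id0 ?rpred_rat //.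
  by rewrite -/(rat_emb charL 0) rmorph0.
by rewrite rpred_div.
Qed.

Lemma in_Qadjoin_exp z i x : in_Qadjoin (z ^+ i) x -> in_Qadjoin z x.
Proof.
apply: in_Qadjoin_trans; apply/(QadjoinP charL); rewrite rpredX //.
exact/QadjoinP/in_Qadjoin_gen.
Qed.

(** Elements of [Q(w)], for [w] a root of unity, are polynomials in [w]: the
    factor [g] of [X ^ l - 1] coprime to the denominator [s] vanishes at [w], so
    a Bezout relation between [s] and [g] inverts [s] at [w]. *)
Lemma in_Qadjoin_unity_poly l w x : (0 < l)%N -> w ^+ l = 1 -> in_Qadjoin w x ->
  exists f : {poly rat}, x = (f^q).[w].
Proof.
move=> l_gt0 wl /(in_QadjoinE charL)[r [s [s0 ->]]].
have nz : ('X^l - 1 : {poly rat}) != 0 by rewrite monic_neq0 // monicXnsubC.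
pose g := gdcop s ('X^l - 1).
have gw : (g^q).[w] = 0.
  apply/rootP; rewrite /g gdcop_map rmorphB rmorphXn rmorph1 /= map_polyX root_gdco.
    by rewrite s0 andbT /root !hornerE wl subrr.
  by rewrite monic_neq0 // monicXnsubC.
have /Bezout_coprimepP[[u v] /= /eqpP[[c1 c2] /= /andP[c10 c20] e]] := coprimep_gdco s nz.
have {}e : (c1 *: (u * g + v * s))^q.[w] = ((c2 *: 1)^q).[w] by rewrite e.
move: e; rewrite !map_polyZ rmorphD !rmorphM /= rmorph1 !hornerE gw mulr0 add0r => e.
have c1L : rat_emb charL c1 != 0 by rewrite fmorph_eq0.
have c2L : rat_emb charL c2 != 0 by rewrite fmorph_eq0.
exists (r * ((c1 / c2) *: v)); rewrite rmorphM /= hornerM map_polyZ hornerZ.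
rewrite fmorph_div /=.
have -> : (v^q).[w] = rat_emb charL c2 / rat_emb charL c1 / (s^q).[w].
  by rewrite -e; field; rewrite s0 c1L.
by field; rewrite s0 c1L c2L.
Qed.

(** The cyclotomic polynomial over the rational numbers. *)
Definition PhiQ l : {poly rat} := map_poly intr ('Phi_l).

Lemma PhiQ_emb l : (PhiQ l)^q = map_poly intr ('Phi_l).
Proof.
rewrite /PhiQ -map_poly_comp; apply: eq_map_poly => i /=.
exact: ratr_int.
Qed.

Lemma root_PhiQ l w : (l.-primitive_root w)%R -> ((PhiQ l)^q).[w] = 0.
Proof.
move=> prim_w; have l_gt0 := prim_order_gt0 prim_w.
have dvd_Phi d : d \in divisors l -> root ((PhiQ d)^q) w -> w ^+ d = 1.
  move=> dl /rootP rd; have d_gt0 : (0 < d)%N by move: dl; rewrite -dvdn_divisors // => /dvdn_gt0->.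
  have := prod_Cyclotomic d_gt0; move/(congr1 (map_poly (intr : int -> L)))/(congr1 (horner^~ w)).
  rewrite rmorph_prod (big_rem d) /=; last by rewrite -dvdn_divisors.
  rewrite hornerM -PhiQ_emb rd mul0r rmorphB rmorphXn rmorph1 /= map_polyX !hornerE.
  by move/esym/eqP; rewrite subr_eq0 => /eqP.
have := prod_Cyclotomic l_gt0; move/(congr1 (map_poly (intr : int -> L)))/(congr1 (horner^~ w)).
rewrite rmorph_prod rmorphB rmorphXn rmorph1 /= map_polyX !hornerE (prim_expr_order prim_w) subrr.
rewrite horner_prod => /eqP; rewrite prodf_seq_eq0 => /hasP[d dl /= /eqP rd].
rewrite -PhiQ_emb in rd.
have /(dvd_Phi d dl) wd : root ((PhiQ d)^q) w by apply/rootP.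
have : (l %| d)%N by rewrite (prim_order_dvd prim_w) wd.
rewrite -dvdn_divisors // in dl => ld.
have /eqP dE : d == l by rewrite eqn_dvd dl ld.
by rewrite -dE.
Qed.

(** [PhiQ l] divides every rational polynomial vanishing at a primitive [l]-th
    root of unity of [L]. This transfers irreducibility from the algebraic
    numbers, where [PhiQ l] is a minimal polynomial. *)
Lemma PhiQ_irreducible l (w : L) P : (l.-primitive_root w)%R -> (P^q).[w] = 0 -> PhiQ l %| P.
Proof.
move=> prim_w Pw; have l_gt0 := prim_order_gt0 prim_w.
have [wC prim_wC] := C_prim_root_exists l_gt0.
have [p0 [min_p0 mon_p0 root_p0]] := minCpolyP wC.
have p0E : p0 = PhiQ l.
  apply: (map_inj_poly (fmorph_inj (ratr : rat -> algC)) (rmorph0 _)).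
  rewrite -min_p0 (minCpoly_cyclotomic prim_wC) -(Cintr_Cyclotomic prim_wC) /PhiQ -map_poly_comp.
  by apply: eq_map_poly => i /=; rewrite ratr_int.
pose g := gcdp (PhiQ l) P.
have gw : (g^q).[w] = 0.
  have [[u v] /= e] := Bezoutp (PhiQ l) P.
  have /eqpP[[c1 c2] /= /andP[c10 c20]] := e; move/(congr1 (fun q => (q^q).[w])).
  rewrite !map_polyZ rmorphD !rmorphM /= !hornerE Pw (root_PhiQ prim_w) !mulr0 addr0 mulr0.
  by move/esym/eqP; rewrite mulf_eq0 fmorph_eq0 (negPf c20) => /eqP.
have /dvdpP[h hE] : g %| PhiQ l by exact: dvdp_gcdl.
have : root (map_poly (ratr : rat -> algC) (h * g)) wC by rewrite -hE root_p0 -p0E.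
rewrite rmorphM rootM !root_p0 p0E => /orP[dh|dg]; last exact: dvdp_trans dg (dvdp_gcdr _ _).
have nz : PhiQ l != 0 by rewrite -p0E monic_neq0.
have h0 : h != 0 by apply: contraNneq nz => h0; rewrite hE h0 mul0r.
have g0 : g != 0 by apply: contraNneq nz => g0; rewrite hE g0 mulr0.
have := dvdp_leq h0 dh; rewrite {1}hE size_mul // => le.
have : (size g <= 1)%N.
  rewrite leqNgt; apply/negP => lt; move: le; rewrite leqNgt => /negP[].
  by rewrite -(subnKC lt) addnCA /= ltnS leq_addr.
move/size1_polyC => gE; move: gw; rewrite gE map_polyC hornerC => /eqP.
by rewrite fmorph_eq0 => /eqP c0; rewrite gE c0 eqxx in g0.
Qed.

(** Galois conjugation of a polynomial relation between roots of unity. *)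
Lemma horner_unity_conj l w t P : (l.-primitive_root w)%R -> coprime t l ->
  (P^q).[w] = 0 -> (P^q).[w ^+ t] = 0.
Proof.
move=> prim_w cop /(PhiQ_irreducible prim_w)/dvdpP[h ->].
have prim_wt : (l.-primitive_root (w ^+ t))%R by rewrite prim_root_exp_coprime.
by rewrite rmorphM hornerM (root_PhiQ prim_wt) mulr0.
Qed.

End QadjoinTheory.

(** * Intersections of cyclotomic fields *)
Section RootsOfUnityArithmetic.

(** Chinese remainders for moduli that need not be coprime. *)
Lemma chinese_gcd a b t : (0 < a)%N -> (0 < b)%N -> t = 1 %[mod gcdn a b] ->
  exists2 s, s = t %[mod a] & s = 1 %[mod b].
Proof.
move=> a_gt0 b_gt0 t1; have [u _ dvb] := Bezoutr a b_gt0.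
have ta : (0 < t + a)%N by rewrite addn_gt0 a_gt0 orbT.
have /dvdnP[m mE] : (gcdn a b %| t + a - 1)%N.
  rewrite -eqn_mod_dvd //; apply/eqP; rewrite -modnDm t1 (eqnP (dvdn_gcdl a b)) addn0.
  by rewrite modn_mod.
exists (t + a + a * (u * m))%N.
  by rewrite [(a * _)%N]mulnC addnC modnMDl modnDr.
rewrite -[(t + a)%N](subnKC ta) mE -addnA.
have -> : (m * gcdn a b + a * (u * m) = m * (gcdn a b + u * a))%N.
  by rewrite mulnDr [(a * _)%N]mulnC -mulnA mulnCA.
have /dvdnP[v ->] := dvb.
by rewrite mulnA addnC modnMDl.
Qed.

Lemma partn_dvd_logn (pi : nat_pred) m c : (0 < m)%N -> (0 < c)%N ->
  (forall q, q \in pi -> logn q m <= logn q c)%N -> (m`_pi %| c`_pi)%N.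
Proof.
move=> m_gt0 c_gt0 H; apply/dvdn_partP => [|q]; first exact: part_gt0.
rewrite mem_primes => /and3P[q_pr _ dq].
have qpi : q \in pi by have /pnatP := part_pnat pi m; apply=> //; exact: part_gt0.
have sub : {subset (q : nat_pred) <= pi} by move=> r; rewrite inE => /eqP->.
rewrite partn_part //.
apply: dvdn_trans (dvdn_part q _); rewrite partn_part // !p_part.
by rewrite dvdn_exp2l // H.
Qed.

(** The least common multiple is a product of coprime divisors of its
    arguments: take from [m] the part at the primes where [m] has at least the
    valuation of [c]. *)
Lemma lcmn_coprime_split m c : (0 < m)%N -> (0 < c)%N ->
  exists m1 c1, [/\ (m1 %| m)%N, (c1 %| c)%N, coprime m1 c1 & (m1 * c1 = lcmn m c)%N].
Proof.
move=> m_gt0 c_gt0; pose pi : nat_pred := [pred q | logn q c <= logn q m]%N.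
exists (m`_pi)%N, (c`_(pi^'))%N; split; rewrite ?dvdn_part ?coprime_partC //.
apply/eqP; rewrite eqn_dvd Gauss_dvd ?coprime_partC //.
rewrite (dvdn_trans (dvdn_part _ _) (dvdn_lcml _ _)).
rewrite (dvdn_trans (dvdn_part _ _) (dvdn_lcmr _ _)) dvdn_lcm /=.
apply/andP; split.
  rewrite -{1}(partnC pi m_gt0) dvdn_mul // partn_dvd_logn // => q.
  by rewrite !inE -ltnNge => /ltnW.
by rewrite -{1}(partnC pi c_gt0) dvdn_mul // partn_dvd_logn // => q; rewrite inE.
Qed.

Lemma prim_root_lcm (L : fieldType) m c (x y : L) :
  (m.-primitive_root x)%R -> (c.-primitive_root y)%R ->
  exists w : L, ((lcmn m c).-primitive_root w)%R.
Proof.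
move=> px py; have m_gt0 := prim_order_gt0 px; have c_gt0 := prim_order_gt0 py.
have [m1 [c1 [dm dc cop <-]]] := lcmn_coprime_split m_gt0 c_gt0.
have px1 := dvdn_prim_root px dm; have py1 := dvdn_prim_root py dc.
set x1 := x ^+ _ in px1; set y1 := y ^+ _ in py1.
have m1_gt0 := prim_order_gt0 px1; have c1_gt0 := prim_order_gt0 py1.
exists (x1 * y1).
have xy1 : (x1 * y1) ^+ (m1 * c1) = 1.
  rewrite exprMn exprM (prim_expr_order px1) expr1n mul1r mulnC exprM.
  by rewrite (prim_expr_order py1) expr1n.
have mc_gt0 : (0 < m1 * c1)%N by rewrite muln_gt0 m1_gt0.
have [o po od] := prim_order_exists mc_gt0 xy1.
suff -> : (m1 * c1)%N = o by [].
apply/eqP; rewrite eqn_dvd od andbT Gauss_dvd //; apply/andP; split.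
  rewrite -(Gauss_dvdl o cop) (prim_order_dvd px1).
  have : (x1 * y1) ^+ (o * c1) = 1 by rewrite exprM (prim_expr_order po) expr1n.
  by rewrite exprMn [y1 ^+ _]exprM exprAC (prim_expr_order py1) expr1n mulr1 => ->.
rewrite coprime_sym in cop; rewrite -(Gauss_dvdl o cop) (prim_order_dvd py1).
have : (x1 * y1) ^+ (o * m1) = 1 by rewrite exprM (prim_expr_order po) expr1n.
by rewrite exprMn [x1 ^+ _]exprM exprAC (prim_expr_order px1) expr1n mul1r => ->.
Qed.

End RootsOfUnityArithmetic.

Section QadjoinCap.
Variables (L : fieldType) (charL : [pchar L] =i pred0).
Local Notation "p ^q" := (map_poly (rat_emb charL) p) (at level 2, format "p ^q").

(** The rational polynomial whose roots are the primitive [a]-th roots of unity. *)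
Definition prim_poly a : {poly rat} :=
  gdcop (\prod_(o <- divisors a | o != a) ('X^o - 1)) ('X^a - 1).

Lemma root_prim_poly (F : fieldType) (f : {rmorphism rat -> F}) a (y : F) : (0 < a)%N ->
  root (map_poly f (prim_poly a)) y = (a.-primitive_root y)%R.
Proof.
move=> a_gt0; have mapX o : map_poly f ('X^o - 1) = 'X^o - 1.
  by rewrite rmorphB rmorphXn rmorph1 /= map_polyX.
rewrite /prim_poly gdcop_map rmorph_prod mapX root_gdco; last first.
  by rewrite monic_neq0 // monicXnsubC.
under eq_bigr do rewrite /= mapX.
have rX o : root ('X^o - 1) y = (y ^+ o == 1) by rewrite /root !hornerE subr_eq0.
rewrite rX; apply/andP/idP => [[/eqP ya nr]|prim_y].
  have [o po oa] := prim_order_exists a_gt0 ya.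
  have [<-//|noa] := eqVneq o a.
  case/negP: nr; rewrite /root horner_prod prodf_seq_eq0; apply/hasP; exists o.
    by rewrite -dvdn_divisors.
  by rewrite noa -/(root _ _) rX (prim_expr_order po) eqxx.
rewrite (prim_expr_order prim_y) eqxx; split=> //; apply/negP.
rewrite /root horner_prod prodf_seq_eq0 => /hasP[o]; rewrite -dvdn_divisors // => oa /andP[noa].
rewrite -/(root _ _) rX -(prim_order_dvd prim_y) => ao.
by case/eqP: noa; apply/eqP; rewrite eqn_dvd oa ao.
Qed.

(** An element of [Q(zeta)] fixed by all conjugations that fix [zeta ^ (a / d)]
    lies in [Q(zeta ^ (a / d))]. The roots of [gL] are the conjugates of [zeta]
    over that field, so the remainder of [f] modulo [gL] is the constant [x];
    it can be computed with coefficients in the field. *)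
Lemma Qadjoin_fixed a d (zeta x : L) (f : {poly rat}) :
    (a.-primitive_root zeta)%R -> (d %| a)%N ->
    (forall t, coprime t a -> t = 1 %[mod d] -> (f^q).[zeta ^+ t] = x) ->
  in_Qadjoin (zeta ^+ (a %/ d)) x.
Proof.
move=> prim_z da fix_x; have a_gt0 := prim_order_gt0 prim_z.
set zd := zeta ^+ _; have prim_zd : (d.-primitive_root zd)%R := dvdn_prim_root prim_z da.
pose E := Qadjoin charL zd; pose em : {rmorphism E -> L} := Qadjoin_emb charL zd.
have charE : [pchar E] =i pred0 by move=> q; rewrite -(fmorph_pchar em) charL.
have embE (q : {poly rat}) : map_poly em (map_poly (rat_emb charE) q) = q^q.
  by rewrite -map_poly_comp; apply: eq_map_poly => c; exact: (fmorph_rat em).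
have [zE zdE] := (Qadjoin_embP charL zd zd).1 (in_Qadjoin_gen charL zd).
pose gE := gcdp (map_poly (rat_emb charE) (prim_poly a)) ('X^(a %/ d) - zE%:P).
pose gL : {poly L} := gcdp (prim_poly a)^q ('X^(a %/ d) - zd%:P).
have gLE : map_poly em gE = gL.
  rewrite gcdp_map embE; congr gcdp.
  have -> : map_poly em ('X^(a %/ d) - zE%:P) = map_poly em 'X^(a %/ d) - map_poly em zE%:P.
    exact: raddfB.
  by rewrite map_polyXn map_polyC; congr (_ - _%:P); exact: esym zdE.
have rg y : root gL y = (a.-primitive_root y)%R && (y ^+ (a %/ d) == zd).
  by rewrite root_gcd root_prim_poly // /root !hornerE subr_eq0.
have gz : root gL zeta by rewrite rg prim_z eqxx.
have nz1 : ('X^a - 1 : {poly L}) != 0 by rewrite monic_neq0 // monicXnsubC.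
have gX : gL %| 'X^a - 1.
  apply: dvdp_trans (dvdp_gcdl _ _) _.
  have -> : 'X^a - 1 = ('X^a - 1)^q by rewrite rmorphB rmorphXn rmorph1 /= map_polyX.
  by rewrite dvdp_map; exact: dvdp_gdco.
have gL0 : gL != 0 by apply: contraNneq nz1 => g0; rewrite -dvd0p -g0.
have size_g : (1 < size gL)%N.
  rewrite ltnNge; apply/negP => /size1_polyC gC; move: gz gL0; rewrite gC rootC => /eqP->.
  by rewrite eqxx.
have dv : gL %| f^q - x%:P.
  move: (gX); rewrite -(factor_Xn_sub_1 prim_z) => /dvdp_prod_XsubC[m gm].
  set rs := mask m _ in gm.
  have prodE : \prod_(i <- rs) ('X - (zeta ^+ i)%:P) =
      \prod_(y <- [seq zeta ^+ i | i <- rs]) ('X - y%:P) by rewrite big_map.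
  rewrite prodE in gm; rewrite (eqp_dvdl _ gm).
  have rs_root y : y \in [seq zeta ^+ i | i <- rs] -> root gL y.
    by move=> ry; rewrite (eqp_root gm) root_prod_XsubC.
  apply: uniq_roots_dvdp.
    apply/allP => y ry; have := rs_root _ ry; rewrite rg => /andP[py /eqP yd].
    have [i _ yE] := mapP ry; rewrite yE in py yd *.
    rewrite /root !hornerE fix_x ?subrr //; first by rewrite -(prim_root_exp_coprime _ prim_z).
    by apply/eqP; rewrite -(eq_prim_root_expr prim_zd) expr1 -[in X in _ == X]yd /zd -!exprM mulnC.
  rewrite uniq_rootsE map_inj_in_uniq; first by rewrite mask_uniq // iota_uniq.
  move=> i j /mem_mask; rewrite mem_index_iota => /andP[_ li] /mem_mask.
  rewrite mem_index_iota => /andP[_ lj] /eqP.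
  by rewrite (eq_prim_root_expr prim_z) !modn_small // => /eqP.
have modx : f^q %% gL = x%:P.
  rewrite -[f^q](subrK x%:P) modpD (modp_eq0P _ _ _) ?add0r //.
  by rewrite modp_small // (leq_ltn_trans (size_polyC_leq1 _)).
apply/(Qadjoin_embP charL); exists (map_poly (rat_emb charE) f %% gE)`_0.
have : map_poly em (map_poly (rat_emb charE) f %% gE) = x%:P by rewrite map_modp embE gLE.
by move/(congr1 (fun q : {poly L} => q`_0)); rewrite coef_map coefC.
Qed.

(** The intersection of two cyclotomic fields. *)
Lemma Qadjoin_cap a b (w x : L) :
    ((lcmn a b).-primitive_root w)%R ->
    in_Qadjoin (w ^+ (lcmn a b %/ a)) x -> in_Qadjoin (w ^+ (lcmn a b %/ b)) x ->
  in_Qadjoin (w ^+ (lcmn a b %/ gcdn a b)) x.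
Proof.
set l := lcmn a b => prim_w xa xb; have l_gt0 := prim_order_gt0 prim_w.
have [a_gt0 b_gt0] : (0 < a)%N /\ (0 < b)%N by apply/andP; rewrite -lcmn_gt0.
have al : (a %| l)%N := dvdn_lcml a b; have bl : (b %| l)%N := dvdn_lcmr a b.
have prim_a := dvdn_prim_root prim_w al; have prim_b := dvdn_prim_root prim_w bl.
have [fa xfa] := in_Qadjoin_unity_poly charL a_gt0 (prim_expr_order prim_a) xa.
have [fb xfb] := in_Qadjoin_unity_poly charL b_gt0 (prim_expr_order prim_b) xb.
have conj_x t : coprime t l -> t = 1 %[mod b] -> (fa^q).[(w ^+ (l %/ a)) ^+ t] = x.
  move=> cop t1; pose P := (fa \Po 'X^(l %/ a)) - (fb \Po 'X^(l %/ b)).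
  have PE y : (P^q).[y] = (fa^q).[y ^+ (l %/ a)] - (fb^q).[y ^+ (l %/ b)].
    by rewrite /P rmorphB /= !map_comp_poly !map_polyXn !hornerE !horner_comp !hornerXn.
  have : (P^q).[w ^+ t] = 0.
    by apply: horner_unity_conj prim_w cop _; rewrite PE -xfa -xfb subrr.
  rewrite PE [in X in X - _]exprAC [in X in _ - X]exprAC => /eqP; rewrite subr_eq0 => /eqP->.
  suff -> : (w ^+ (l %/ b)) ^+ t = w ^+ (l %/ b) by [].
  by rewrite -{2}[w ^+ (l %/ b)]expr1; apply/eqP; rewrite (eq_prim_root_expr prim_b) t1.
have -> : w ^+ (l %/ gcdn a b) = (w ^+ (l %/ a)) ^+ (a %/ gcdn a b).
  by rewrite -exprM muln_divA ?dvdn_gcdl // divnK.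
apply: (Qadjoin_fixed (f := fa) prim_a (dvdn_gcdl a b)) => t cop t1.
have [s sa sb] := chinese_gcd a_gt0 b_gt0 t1.
have cop_s : coprime s l.
  have ca : coprime s a by rewrite -coprime_modl sa coprime_modl.
  have cb : coprime s b by rewrite -coprime_modl sb coprime_modl coprime1n.
  apply: coprime_dvdr (_ : l %| a * b)%N _; last by rewrite coprimeMr ca.
  by rewrite dvdn_lcm dvdn_mulr ?dvdn_mull.
rewrite -(conj_x s cop_s sb); congr (_.[_]); apply/eqP.
by rewrite (eq_prim_root_expr prim_a) sa.
Qed.

End QadjoinCap.

(** * Conductors *)
(** Membership in [Q(z)] does not depend on the ambient field. *)
Lemma in_Qadjoin_morph (K L : fieldType) (charK : [pchar K] =i pred0)
    (j : {rmorphism K -> L}) (z x : K) :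
  in_Qadjoin (j z) (j x) <-> in_Qadjoin z x.
Proof.
have E (r : {poly rat}) : (map_poly ratr r).[j z] = j (map_poly ratr r).[z].
  rewrite -/(rat_emb charK) -horner_map -map_poly_comp; congr (_.[_]).
  by apply: eq_map_poly => c; rewrite /= /rat_emb fmorph_rat.
split=> -[r [s [s0 xE]]]; exists r, s.
  rewrite !E in s0 xE; rewrite fmorph_eq0 in s0; split=> //.
  by apply: (fmorph_inj j); rewrite fmorph_div.
by rewrite !E fmorph_eq0 xE fmorph_div.
Qed.

Section Conductor.
Variables (K : fieldType) (charK : [pchar K] =i pred0).
Variables (n : nat) (z : K).
Hypothesis prim_z : (n.-primitive_root z)%R.
Variable S : set K.
Hypothesis S_z : forall x, S x -> in_Qadjoin z x.
Let n_gt0 : (0 < n)%N := prim_order_gt0 prim_z.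

Lemma sub_cyclotomic_dvd m : (m %| n)%N ->
  (forall x, S x -> in_Qadjoin (z ^+ (n %/ m)) x) -> sub_cyclotomic S m.
Proof.
by move=> mn Sm; exists K, idfun, (z ^+ (n %/ m)); split; first exact: dvdn_prim_root.
Qed.

Lemma sub_cyclotomic_gcd m q : sub_cyclotomic S m -> (q %| n)%N ->
  (forall x, S x -> in_Qadjoin (z ^+ (n %/ q)) x) -> sub_cyclotomic S (gcdn m q).
Proof.
move=> [L [j [z' [prim_z' Sm]]]] qn Sq.
have charL : [pchar L] =i pred0 by move=> r; rewrite (fmorph_pchar j) charK.
have prim_y : (q.-primitive_root (j (z ^+ (n %/ q))))%R.
  by rewrite fmorph_primitive_root dvdn_prim_root.
have [w prim_w] := prim_root_lcm prim_z' prim_y.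
have wm := dvdn_prim_root prim_w (dvdn_lcml m q).
have wq := dvdn_prim_root prim_w (dvdn_lcmr m q).
have gl : (gcdn m q %| lcmn m q)%N by apply: dvdn_trans (dvdn_gcdl m q) (dvdn_lcml m q).
exists L, j, (w ^+ (lcmn m q %/ gcdn m q)); split; first exact: dvdn_prim_root.
move=> x Sx; apply: (Qadjoin_cap charL prim_w).
  have [i zi] := prim_rootP wm (prim_expr_order prim_z').
  by apply: (in_Qadjoin_exp charL (i := i)); rewrite -zi; exact: Sm.
have [i yi] := prim_rootP wq (prim_expr_order prim_y).
apply: (in_Qadjoin_exp charL (i := i)); rewrite -yi.
by apply/(in_Qadjoin_morph charK); exact: Sq.
Qed.

(** The values lie in the field generated by a primitive [m]-th root of unity,
    for [m] dividing [n], exactly when the conductor divides [m]. *)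
Lemma conductor_dvdP :
  [/\ (conductor S %| n)%N, (0 < conductor S)%N
    & forall m, (m %| n)%N ->
        (forall x, S x -> in_Qadjoin (z ^+ (n %/ m)) x) <-> (conductor S %| m)%N].
Proof.
have Sn : forall x, S x -> in_Qadjoin (z ^+ (n %/ n)) x by rewrite divnn n_gt0 expr1.
have ex : exists m, (0 < m)%N && `[< sub_cyclotomic S m >].
  by exists n; rewrite n_gt0; apply/asboolP/sub_cyclotomic_dvd.
have [c /andP[c_gt0 /asboolP Sc] c_min] := ex_minnP ex.
have : [/\ (0 < conductor S)%N, sub_cyclotomic S (conductor S)
    & forall m, (0 < m)%N -> sub_cyclotomic S m -> (conductor S <= m)%N].
  rewrite /conductor; set P := (P in xget _ P).
  suff : P (xget 0%N P) by []; apply: xgetPex; exists c; split=> // m m_gt0 Sm.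
  by apply: c_min; rewrite m_gt0; apply/asboolP.
move: (conductor S) => {c c_gt0 Sc c_min ex} c [c_gt0 Sc c_min].
have Pc m : (m %| n)%N -> (forall x, S x -> in_Qadjoin (z ^+ (n %/ m)) x) -> (c %| m)%N.
  move=> mn Sm; have g_gt0 : (0 < gcdn c m)%N by rewrite gcdn_gt0 c_gt0.
  have := c_min _ g_gt0 (sub_cyclotomic_gcd Sc mn Sm) => le.
  have /eqP e : gcdn c m == c by rewrite eqn_leq le dvdn_leq // dvdn_gcdl.
  by rewrite -e dvdn_gcdr.
have cn : (c %| n)%N by apply: Pc.
split=> // m mn; split; first exact: Pc.
move=> cm x Sx; have [L [j [z' [prim_z' Sj]]]] := Sc.
have prim_y : (c.-primitive_root (j (z ^+ (n %/ c))))%R.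
  by rewrite fmorph_primitive_root dvdn_prim_root.
have charL : [pchar L] =i pred0 by move=> r; rewrite (fmorph_pchar j) charK.
have [i zi] := prim_rootP prim_y (prim_expr_order prim_z').
apply: (in_Qadjoin_exp charK (i := m %/ c)).
rewrite -exprM [(n %/ m * _)%N]muln_divA // divnK //.
apply/(in_Qadjoin_morph charK j)/(in_Qadjoin_exp charL (i := i)).
by rewrite -zi; exact: Sj.
Qed.

End Conductor.

Lemma irrchar_in_Qadjoin (gT : finGroupType) (K : fieldType) (G : {group gT}) n (z : K) chi g
    (charK : [pchar K] =i pred0) :
  (n.-primitive_root z)%R -> (#|G| %| n)%N -> irrchar G chi -> g \in G -> in_Qadjoin z (chi g : K).
Proof.
move=> prim_z dvG [d [rG [_ ->]]] Gg.
have og : (#[g]%g %| n)%N by apply: dvdn_trans dvG; exact: order_dvdG.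
have [D trD D1] := mxtrace_repr_roots rG prim_z Gg og.
rewrite rcharE // trD; apply/(QadjoinP charK); apply: rpred_sum => i _.
have Dn : D i ^+ n = 1 by case/dvdnP: og => q ->; rewrite mulnC exprM D1 expr1n.
have [k ->] := prim_rootP prim_z Dn.
by rewrite rpredX //; apply/QadjoinP/(in_Qadjoin_gen charK).
Qed.

(** The valuation at [p] of a divisor [c] of [n] is determined by the divisors
    [m] of [n] that are multiples of both [c] and the [p']-part of [n]. *)
Lemma logn_le_of_dvd_part p n c c' : prime p -> (0 < n)%N -> (c %| n)%N -> (0 < c')%N ->
    (forall m, (partn n p^' %| m)%N -> (m %| n)%N -> (c %| m)%N -> (c' %| m)%N) ->
  (logn p c' <= logn p c)%N.
Proof.
move=> p_pr n_gt0 cn c'_gt0 H; have c_gt0 := dvdn_gt0 n_gt0 cn.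
pose m := (p ^ logn p c * partn n p^')%N.
have m_gt0 : (0 < m)%N by rewrite muln_gt0 expn_gt0 prime_gt0 // part_gt0.
have mn : (m %| n)%N.
  rewrite -(partnC p n_gt0); apply: dvdn_mul => //.
  by rewrite p_part dvdn_exp2l // dvdn_leq_log.
have cm : (c %| m)%N.
  rewrite -(partnC p c_gt0); apply: dvdn_mul; last exact: partn_dvd.
  by rewrite p_part.
have := dvdn_leq_log p m_gt0 (H m (dvdn_mull _ (dvdnn _)) mn cm).
suff -> : logn p m = logn p c by [].
have p'_n : logn p (partn n p^') = 0%N.
  by rewrite lognE -[(p %| _)%N]negbK -p'natE // part_pnat !andbF.
rewrite lognM ?part_gt0 ?expn_gt0 ?(prime_gt0 p_pr) //.
by rewrite pfactorK // p'_n addn0.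
Qed.

(** An isotypy preserves the [p]-parts of the conductors. *)
Lemma isotypy_char_conductor (p : nat) (O : idomainType) (K k : fieldType)
    (iota : {rmorphism O -> K}) (res : {rmorphism O -> k})
    (hOKk : modular_system p iota res)
    (gT gT' : finGroupType) (G : {group gT}) (G' : {group gT'}) b b'
    (hb : is_block G b) (hb' : is_block G' b') n (z : K)
    (prim_z : (n.-primitive_root z)%R) (dvG : (#|G| %| n)%N) (dvG' : (#|G'| %| n)%N)
    (J : {linear kfun gT K -> kfun gT' K}) R R' f Iloc
    (iso : is_isotypy p iota res G G' b b' J R R' f Iloc)
    (I : kfun gT K -> kfun gT' K) (ind : induced_bijection iota G G' b b' J I)
    (chi : kfun gT K) (hchi : Irr iota G b chi) :
  partn (char_conductor G' (I chi)) p = partn (char_conductor G chi) p.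
Proof.
have [[I0b _ _] I0J] := ind.
have charK := modsys_charK hOKk; have p_pr := modsys_prime hOKk.
have n_gt0 := prim_order_gt0 prim_z.
have bc : central_idem G b by case: hb.
have bc' : central_idem G' b' by case: hb'.
have Ic : irrchar G chi := Irr_irrchar hchi.
have Ic' : irrchar G' (I chi) := Irr_irrchar (I0b _ hchi).
have transfer (E : fieldType) (eps : {rmorphism E -> K}) :
    (forall w : K, w ^+ partn n p^' = 1 -> exists y, w = eps y) ->
  valued eps chi <-> valued eps (I chi).
  move=> hE; have := isotypy_valued hOKk prim_z hE dvG dvG' bc bc' iso (Irr_block_cf hOKk prim_z dvG bc hchi).
  have [-> //|->] := I0J _ hchi => ->; split=> v x; have [y yE] := v x; exists (- y).
    by rewrite rmorphN -yE ffunE opprK.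
  by rewrite rmorphN -yE ffunE.
pose SG := [set x : K | exists2 g, g \in G & x = chi g]%classic.
pose SG' := [set x : K | exists2 g, g \in G' & x = I chi g]%classic.
have SGz x : SG x -> in_Qadjoin z x.
  by move=> [g Gg ->]; exact: (irrchar_in_Qadjoin charK prim_z dvG).
have SGz' x : SG' x -> in_Qadjoin z x.
  by move=> [g Gg ->]; exact: (irrchar_in_Qadjoin charK prim_z dvG').
have [cn c_gt0 cP] := conductor_dvdP charK prim_z SGz.
have [cn' c_gt0' cP'] := conductor_dvdP charK prim_z SGz'.
have dvd_iff m : (partn n p^' %| m)%N -> (m %| n)%N ->
    (conductor SG %| m)%N <-> (conductor SG' %| m)%N.
  move=> pm mn; rewrite -(cP m mn) -(cP' m mn).
  have hE (w : K) : w ^+ partn n p^' = 1 -> exists y, w = Qadjoin_emb charK (z ^+ (n %/ m)) y.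
    move=> wn; apply/Qadjoin_embP.
    have wm : w ^+ m = 1 by case/dvdnP: pm => q ->; rewrite mulnC exprM wn expr1n.
    have [i ->] := prim_rootP (dvdn_prim_root prim_z mn) wm.
    by apply/(QadjoinP charK); rewrite rpredX //; apply/QadjoinP/(in_Qadjoin_gen charK).
  have valE (gT0 : finGroupType) (G0 : {group gT0}) (phi : kfun gT0 K) : irrchar G0 phi ->
      (forall x, (exists2 g, g \in G0 & x = phi g) -> in_Qadjoin (z ^+ (n %/ m)) x) <->
      valued (Qadjoin_emb charK (z ^+ (n %/ m))) phi.
    move=> /irrchar_kclass[phi0 _]; split=> [H x|v x [g _ ->]]; last exact/(Qadjoin_embP charK).
    have [Gx|/phi0->] := boolP (x \in G0); last by exists 0; rewrite rmorph0.
    by apply/Qadjoin_embP/H; exists x.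
  by rewrite (valE _ _ _ Ic) (valE _ _ _ Ic'); exact: transfer.
rewrite /char_conductor !p_part; congr (p ^ _)%N; apply/eqP; rewrite eqn_leq.
apply/andP; split; apply: (logn_le_of_dvd_part p_pr n_gt0) => // m pm mn.
  by move/(dvd_iff m pm mn).
by move/(dvd_iff m pm mn).
Qed.

Local Close Scope ring_scope.
Local Close Scope group_scope.

Theorem theorem1p4 (p : nat) (O : idomainType) (K k : fieldType)
    (iota : {rmorphism O -> K}) (res : {rmorphism O -> k})
    (hOKk : modular_system p iota res)
    (gT gT' : finGroupType) (G : {group gT}) (G' : {group gT'})
    (b : {ffun gT -> O}) (b' : {ffun gT' -> O})
    (hb : is_block G b) (hb' : is_block G' b')
    (hK : exists n (z : K),
       [/\ (n.-primitive_root z)%R, #|G| %| n & #|G'| %| n])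
    (hiso : isotypic p iota res G G' b b')
    (I : kfun gT K -> kfun gT' K)
    (hI : induced_by_isotypy p iota res G G' b b' I)
    (chi : kfun gT K) (hchi : Irr iota G b chi) :
  (char_conductor G' (I chi))`_p = (char_conductor G chi)`_p.
Proof.
have [n [z [prim_z dvG dvG']]] := hK.
have [J [R [R' [f [Iloc [iso ind]]]]]] := hI.
exact: (isotypy_char_conductor hOKk hb hb' prim_z dvG dvG' iso ind hchi).
Qed.
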